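(* Let $n\geq 3$ and $d:=\phi(n)$, where $\phi$ is Euler's totient function. Then there exist simple $d$-dimensional noncommutative tori $\mathcal{A}_\Theta$ on which the group $\mathbb{Z}_n=\langle C_n\rangle$ acts canonically; that is, there exist real skew symmetric $d\times d$ matrices $\Theta$ with $C_n^t\Theta C_n=\Theta$ such that the $C^*$-algebra $\mathcal{A}_\Theta$ is simple.
   Context: For a real skew symmetric $d\times d$ matrix $\Theta=(\theta_{kj})$, the noncommutative $d$-torus $\mathcal{A}_\Theta$ is the universal $C^*$-algebra generated by unitaries $u_1,\dots,u_d$ subject to $u_ju_k=\exp(2\pi i\theta_{kj})u_ku_j$. Equivalently, $\mathcal{A}_\Theta=C^*(\mathbb{Z}^d,\omega_\Theta)$ is the twisted group $C^*$-algebra for the 2-cocycle $\omega_\Theta(x,y)=\exp(\pi i\langle\Theta x,y\rangle)$, with canonical unitaries $l_\Theta(x)$, $x\in\mathbb{Z}^d$, satisfying $l_\Theta(x)l_\Theta(y)=\omega_\Theta(x,y)l_\Theta(x+y)$, and $u_i=l_\Theta(e_i)$. Let $G_\Theta:=\{A\in \mathrm{GL}_d(\mathbb{Z}): A^t\Theta A=\Theta\}$. For a subgroup $G\subset G_\Theta$, the canonical action of $G$ on $\mathcal{A}_\Theta$ is $\alpha_A(l_\Theta(x))=l_\Theta(Ax)$ for $A\in G$, $x\in\mathbb{Z}^d$; a subgroup $G$ of $\mathrm{GL}_d(\mathbb{Z})$ is said to act canonically on $\mathcal{A}_\Theta$ when $G\subset G_\Theta$. The companion matrix of a monic polynomial $a_0+a_1x+\cdots+a_{d-1}x^{d-1}+x^d$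 is the $d\times d$ matrix $C$ with $Ce_i=e_{i+1}$ for $1\le i\le d-1$ and $Ce_d=-a_0e_1-a_1e_2-\cdots-a_{d-1}e_d$. $C_n\in\mathrm{GL}_d(\mathbb{Z})$ denotes the companion matrix of the $n$th cyclotomic polynomial (of degree $d=\phi(n)$); it has order $n$, and $\langle C_n\rangle$ is the cyclic group it generates. *)

(* Defs.v *)
From HB Require Import structures.
From mathcomp Require Import all_boot all_order all_algebra all_field.
From mathcomp Require Import complex.
From mathcomp Require Import all_classical all_reals all_analysis.

Set Implicit Arguments.
Unset Strict Implicit.
Unset Printing Implicit Defensive.

Import Order.TTheory GRing.Theory Num.Theory.
Import numFieldNormedType.Exports.

Local Open Scope classical_set_scope.
Local Open Scope complex_scope.
Local Open Scope ring_scope.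

(* Unital, nonzero C*-algebras over R[i].  The norm of a [normedModType R[i]] *)
(* takes its (real, nonnegative) values in R[i].  The product is a field of   *)
(* the record, rather than an [algType] structure to be joined with           *)
(* [completeNormedModType], because Hierarchy Builder rejects a new join of   *)
(* rings and normed modules; the [algType] structure is derived below.        *)
Record cstarAlgebra (R : realType) := CStarAlgebra {
  cstar_banach : completeNormedModType R[i];
  cstar_one : cstar_banach;
  cstar_mul : cstar_banach -> cstar_banach -> cstar_banach;
  cstar_star : cstar_banach -> cstar_banach;
  cstar_mulA : associative cstar_mul;
  cstar_mul1r : left_id cstar_one cstar_mul;
  cstar_mulr1 : right_id cstar_one cstar_mul;
  cstar_mulDl : left_distributive cstar_mul +%R;
  cstar_mulDr : right_distributive cstar_mul +%R;
  cstar_one_neq0 : cstar_one != 0;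
  cstar_scaleAl : forall (c : R[i]) a b,
    c *: cstar_mul a b = cstar_mul (c *: a) b;
  cstar_scaleAr : forall (c : R[i]) a b,
    c *: cstar_mul a b = cstar_mul a (c *: b);
  cstar_starK : involutive cstar_star;
  cstar_starD : {morph cstar_star : a b / a + b};
  cstar_starZ : forall (c : R[i]) a,
    cstar_star (c *: a) = Num.conj c *: cstar_star a;
  cstar_starM : forall a b,
    cstar_star (cstar_mul a b) = cstar_mul (cstar_star b) (cstar_star a);
  cstar_ler_normM : forall a b, `|cstar_mul a b| <= `|a| * `|b|;
  cstar_normE : forall a, `|cstar_mul (cstar_star a) a| = `|a| ^+ 2
}.

Definition cstar_carrier (R : realType) (A : cstarAlgebra R) : Type :=
  cstar_banach A.
Coercion cstar_carrier : cstarAlgebra >-> Sortclass.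

HB.instance Definition _ (R : realType) (A : cstarAlgebra R) :=
  CompleteNormedModule.copy (cstar_carrier A) (cstar_banach A).
HB.instance Definition _ (R : realType) (A : cstarAlgebra R) :=
  GRing.Zmodule_isNzRing.Build (cstar_carrier A)
    (@cstar_mulA R A) (@cstar_mul1r R A) (@cstar_mulr1 R A)
    (@cstar_mulDl R A) (@cstar_mulDr R A) (@cstar_one_neq0 R A).
HB.instance Definition _ (R : realType) (A : cstarAlgebra R) :=
  GRing.Lmodule_isLalgebra.Build R[i] (cstar_carrier A) (@cstar_scaleAl R A).
HB.instance Definition _ (R : realType) (A : cstarAlgebra R) :=
  GRing.Lalgebra_isAlgebra.Build R[i] (cstar_carrier A) (@cstar_scaleAr R A).

Definition star (R : realType) (A : cstarAlgebra R) : A -> A :=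
  @cstar_star R A.

Section CStarAlgebraTheory.
Variables (R : realType) (A : cstarAlgebra R).

Definition unitary (a : A) : Prop := star a * a = 1 /\ a * star a = 1.

(* Stability under scalars is automatic, as c *: a = (c *: 1) * a. *)
Definition closed_ideal (I : set A) : Prop :=
  [/\ closed I, I 0, forall a b, I a -> I b -> I (a + b)
    & forall a b, I b -> I (a * b) /\ I (b * a)].

Definition simple_cstar : Prop :=
  forall I : set A, closed_ideal I -> I = [set 0] \/ I = setT.

Definition cstar_subalgebra (S : set A) : Prop :=
  closed S /\
  [/\ S 1, forall a b, S a -> S b -> S (a + b),
      forall (c : R[i]) a, S a -> S (c *: a),
      forall a b, S a -> S b -> S (a * b)
    & forall a, S a -> S (star a)].

Definition cstar_generated (T : Type) (u : T -> A) : Prop :=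
  forall S : set A, cstar_subalgebra S -> range u `<=` S -> S = setT.

End CStarAlgebraTheory.

Section NoncommutativeTorus.
Variables (R : realType) (d : nat).
Implicit Type Theta : 'M[R]_d.

Definition expi (t : R) : R[i] := cos t +i* sin t.

Definition skew_symmetric Theta : Prop := Theta^T = - Theta.

Definition nctorus_rel Theta (A : cstarAlgebra R) (u : 'I_d -> A) : Prop :=
  (forall j, unitary (u j)) /\
  (forall j k, u j * u k = expi (2 * pi * Theta k j) *: (u k * u j)).

(* [A], with the generators [u], is the noncommutative torus A_Theta.  *)
(* Universality together with generation determines (A, u) up to a     *)
(* unique isomorphism; the comparison *-morphism is unique because     *)
(* *-morphisms of C*-algebras are continuous and [u] generates [A].    *)
Definition is_nctorus Theta (A : cstarAlgebra R) (u : 'I_d -> A) : Prop :=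
  [/\ nctorus_rel Theta u,
      cstar_generated u
    & forall (B : cstarAlgebra R) (v : 'I_d -> B), nctorus_rel Theta v ->
        exists f : {lrmorphism A -> B},
          (forall a, f (star a) = star (f a)) /\ (forall j, f (u j) = v j)].

(* G_Theta, the stabilizer of Theta in GL_d(Z) *)
Definition stab_GLZ Theta : set 'M[int]_d :=
  [set M | M \in unitmx /\
     (map_mx intr M)^T *m Theta *m map_mx intr M = Theta].

(* The subgroup G of GL_d(Z) acts canonically on A_Theta, an element M of G *)
(* sending the canonical unitary l(x) to l(M x).                            *)
Definition acts_canonically (G : set 'M[int]_d) Theta : Prop :=
  G `<=` stab_GLZ Theta.

End NoncommutativeTorus.

(* Acts on column vectors: the j-th column is e_(j+1) for j < d - 1, and the *)
(* last one is minus the vector of lower coefficients of p.  This is the     *)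
(* transpose of [mxpoly.companionmx], with its size as a separate parameter. *)
Definition companion (d : nat) (p : {poly int}) : 'M[int]_d :=
  \matrix_(i, j) if j.+1 == d :> nat then - p`_i else (i == j.+1 :> nat)%:R.

Definition cyclotomic_companion (n : nat) : 'M[int]_(totient n) :=
  companion (totient n) 'Phi_n.

(* The cyclic subgroup of GL_d(Z) generated by an invertible M. *)
Definition cyclic_subgroup (d : nat) (M : 'M[int]_d) : set 'M[int]_d :=
  [set N | exists k : nat, N = M ^+ k \/ N = invmx (M ^+ k)].

(* Main.v *)
(* A_Theta is the norm closure of the left regular representation of the      *)
(* omega-twisted group algebra of Z^d.  Universality: for a projective unitary *)
(* representation in a C*-algebra, the image of a finite sum a has norm at     *)
(* most sqrt(#supp a) |a|_2; applying this to the powers (a* a)^(2^m), whose   *)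
(* norms the C*-identity computes and whose supports grow polynomially, and    *)
(* taking roots, the image of a is bounded by the norm of a in the regular     *)
(* representation.  Simplicity: if the commutator pairing of omega is          *)
(* nondegenerate, iterated averages f |-> (f + u f u* ) / 2 send f to trace(f) *)
(* times 1, the trace is faithful on the regular representation, so a nonzero  *)
(* closed ideal contains 1.  Finally, identify Z^d with Z[zeta], on which C_n  *)
(* acts as multiplication by zeta, and take Theta(x, y) = t Im(x conj(y)):     *)
(* this is invariant because |zeta| = 1, and, for t outside a countable set,   *)
(* t Im(x conj(y)) is an integer only when Im(x conj(y)) = 0.                  *)
Require Import Defs.
From HB Require Import structures.
From mathcomp Require Import all_boot all_order all_algebra all_field.
From mathcomp Require Import complex ring lra.
From mathcomp Require Import all_classical all_reals all_analysis.

Set Implicit Arguments.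
Unset Strict Implicit.
Unset Printing Implicit Defensive.

Import Order.TTheory GRing.Theory Num.Theory.
Import numFieldNormedType.Exports.

Local Open Scope classical_set_scope.
Local Open Scope complex_scope.
Local Open Scope ring_scope.

(** * Spaces of uniform limits of formal linear combinations *)

(** The twisted group algebra of [Z^d] acts on the square-summable functions by its left regular
    representation. The norm closure is shown to be both universal and, for a nondegenerate
    commutator pairing, simple; cyclotomic integers then supply a suitable [Theta].

    Universality rests on [lin_rep_contractive]: every projective unitary representation is bounded
    by the regular norm. Its ingredients are the polynomial growth of supports ([size_supp_lpow])
    and the C*-identity, which computes norms of powers of self-adjoint elements
    ([norm_selfadjoint_exp]). By [ordered_prod_mul], unitaries satisfying the torus relations give
    such a representation through their ordered monomials.

    Simplicity ([tgroup_simple]) combines averaging over conjugations by the canonical unitaries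
    ([avgs_tg]) with faithfulness of the trace ([trace_faithful]).

    The form is [t * Im (x * conj y)] on [Z[z]], with [z] a primitive [n]-th root of unity. Rotation
    by [z] preserves it ([cyclotomic_form_invariant]), and all [t] outside a countable set make its
    exponential nondegenerate ([cyclotomic_form_nondegenerate]). *)

Lemma normc_ge_Im (R : rcfType) (x : R[i]) : `|complex.Im x|%:C <= `|x|.
Proof.
by case: x => a b; simpc; rewrite -sqrtr_sqr ler_wsqrtr // lerDr sqr_ge0.
Qed.

(** [Re] and [Im] are 1-Lipschitz, so the filter converges coordinatewise in the complete field [R],
    and two errors of half the size add up. *)
Lemma complex_complete (R : realType) (F : set_system R[i]) (FF : ProperFilter F) :
  (forall e : R[i], 0 < e -> exists z, F [set w | `|z - w| < e]) ->
  exists l, forall e : R[i], 0 < e -> F [set w | `|l - w| <= e].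
Proof.
move=> Fc.
have part (p : R[i] -> R) : (forall z w, `|p z - p w|%:C <= `|z - w|) ->
    exists l : R, forall e : R, 0 < e -> \forall z \near F, `|l - p z| <= e.
  move=> pL.
  have : cauchy (p @ F).
    apply/cauchyP => e e0; have e0' : 0 < e%:C by rewrite ltcR.
    have [z Fz] := Fc _ e0'; exists (p z).
    rewrite /fmap /=; apply: filterS Fz => w /= zw.
    by rewrite -ball_normE /= -ltcR; apply: le_lt_trans zw.
  move/cauchy_cvg => /cvg_ex [l pl]; exists l => e e0.
  by move/cvgrPdist_le: pl; apply.
have [x Fx] := part (@complex.Re R)
  (fun z w => eq_ind _ (fun u : R => `|u|%:C <= `|z - w|)
     (normc_ge_Re (z - w)) _ (raddfB (@complex.Re R) z w)).
have [y Fy] := part (@complex.Im R)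
  (fun z w => eq_ind _ (fun u : R => `|u|%:C <= `|z - w|)
     (normc_ge_Im (z - w)) _ (raddfB (@complex.Im R) z w)).
exists (x +i* y) => e e0.
have [r re] : exists r : R, e = r%:C.
  by exists (complex.Re e); rewrite RRe_real // gtr0_real.
subst e; move: e0; rewrite ltcR => r0.
have r20 : 0 < r / 2 by rewrite divr_gt0.
near=> z.
rewrite /= [X in `|X|](_ : _ = (x - complex.Re z)%:C + 'i%C * (y - complex.Im z)%:C);
  last by rewrite [LHS]complexE !raddfB.
rewrite (le_trans (ler_normD _ _)) // normrM.
have -> : `|'i%C : R[i]| = 1 by rewrite normc_def /= expr0n /= expr1n add0r sqrtr1.
rewrite mul1r !normc_def /= !expr0n /= !addr0 !sqrtr_sqr -rmorphD lecR.
rewrite (splitr r) lerD //.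
- by near: z; apply: Fx.
- by near: z; apply: Fy.
Unshelve. all: by end_near. Qed.

(* A list of pairs (coefficient, point of X) stands for a finite formal sum;   *)
(* no quotient is taken, as everything is evaluated through some [lin h].      *)
Definition lin (K : nzRingType) (X : Type) (V : lmodType K) (h : X -> V)
  (a : seq (K * X)) : V := \sum_(p <- a) p.1 *: h p.2.

Definition lscale (K : nzRingType) (X : Type) (c : K) (a : seq (K * X)) :=
  [seq (c * p.1, p.2) | p <- a].

Section Lin.
Variables (K : nzRingType) (X : Type) (V : lmodType K).
Implicit Types (h : X -> V) (a b : seq (K * X)).

Lemma lin_nil h : lin h [::] = 0. Proof. exact: big_nil. Qed.

Lemma lin_cons h p a : lin h (p :: a) = p.1 *: h p.2 + lin h a.
Proof. exact: big_cons. Qed.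

Lemma lin_cat h a b : lin h (a ++ b) = lin h a + lin h b.
Proof. exact: big_cat. Qed.

Lemma lin_scale h c a : lin h (lscale c a) = c *: lin h a.
Proof.
rewrite /lin big_map scaler_sumr.
by apply: eq_bigr => p _; rewrite /= scalerA.
Qed.

Lemma lin1 h x : lin h [:: (1, x)] = h x.
Proof. by rewrite /lin big_seq1 scale1r. Qed.

End Lin.

Section UniformSpan.
Variables (R : realType) (X T : Type) (g : X -> T -> R[i]).
Notation K := R[i].

(* Requiring boundedness here, rather than of [g], makes the completeness of   *)
(* [uspan g] unconditional, so that it can be a canonical instance.            *)
Definition in_uspan : pred (T -> K) := fun f =>
  `[< (exists2 M : K, 0 <= M & forall t, `|f t| <= M) /\
      (forall e : K, 0 < e -> exists a : seq (K * X),
         forall t, `|f t - lin (g^~ t) a| <= e) >].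

Lemma in_uspan_submod : submod_closed in_uspan.
Proof.
split.
  apply/asboolP; split; first by exists 0 => // t; rewrite normr0.
  by move=> e e0; exists [::] => t; rewrite lin_nil subrr normr0 ltW.
move=> c f1 f2 /asboolP[[M1 M10 f1M] f1a] /asboolP[[M2 M20 f2M] f2a].
apply/asboolP; split.
  exists (`|c| * M1 + M2) => [|t]; first by rewrite addr_ge0 // mulr_ge0.
  rewrite (le_trans (ler_normD _ _)) // lerD //.
  by rewrite normrM ler_wpM2l.
move=> e e0.
have c0 : 0 < `|c| + 1 by rewrite ltr_wpDl.
have [a1 ha1] := f1a (e / 2 / (`|c| + 1)) (divr_gt0 (divr_gt0 e0 (ltr0n _ 2)) c0).
have [a2 ha2] := f2a (e / 2) (divr_gt0 e0 (ltr0n _ 2)).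
exists (lscale c a1 ++ a2) => t.
rewrite lin_cat lin_scale.
have -> : (c *: f1 + f2) t - (c *: lin (g^~ t) a1 + lin (g^~ t) a2) =
    c * (f1 t - lin (g^~ t) a1) + (f2 t - lin (g^~ t) a2).
  by rewrite mulrBr opprD addrACA.
rewrite (le_trans (ler_normD _ _)) // [leRHS]splitr lerD //.
rewrite normrM (le_trans (ler_wpM2l _ (ha1 t))) //.
rewrite mulrA ler_pdivrMr // mulrC ler_wpM2l ?lerDl //.
by rewrite ltW // divr_gt0.
Qed.

HB.instance Definition _ := GRing.isSubmodClosed.Build K (T -> K) in_uspan
  in_uspan_submod.

(** In the application [T] consists of pairs of vectors and [g x] of matrix coefficients of a
    unitary. An operator is thus encoded by the function of its matrix coefficients at normalized
    vectors, and the operator norm becomes a supremum norm. *)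
Record uspan := Uspan { uspan_fun :> T -> K; _ : uspan_fun \in in_uspan }.
HB.instance Definition _ := [isSub for uspan_fun].
HB.instance Definition _ := [Choice of uspan by <:].
HB.instance Definition _ := [SubChoice_isSubLmodule of uspan by <:].

Lemma uspanP (f1 f2 : uspan) : f1 =1 f2 -> f1 = f2.
Proof. by move=> f12; apply/val_inj/funext. Qed.

Lemma uspanD (f1 f2 : uspan) t : (f1 + f2) t = f1 t + f2 t.
Proof. exact: (congr1 (@^~ t) (raddfD val f1 f2)). Qed.

Lemma uspanN (f : uspan) t : (- f) t = - f t.
Proof. exact: (congr1 (@^~ t) (raddfN val f)). Qed.

Lemma uspanB (f1 f2 : uspan) t : (f1 - f2) t = f1 t - f2 t.
Proof. by rewrite uspanD uspanN. Qed.

Lemma uspan0 t : (0 : uspan) t = 0.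
Proof. exact: (congr1 (@^~ t) (raddf0 (val : uspan -> _))). Qed.

Lemma uspanZ c (f : uspan) t : (c *: f) t = c * f t.
Proof. by []. Qed.

Definition uspan_norm (f : uspan) : K :=
  (sup [set complex.Re `|f t| | t in setT])%:C.

Lemma uspan_norm_le (f : uspan) (M : K) :
  0 <= M -> (forall t, `|f t| <= M) -> uspan_norm f <= M.
Proof.
move=> M0 fM; have MR : (complex.Re M)%:C = M by rewrite RRe_real // ger0_real.
rewrite -MR lecR.
(* For empty [T] the supremum is that of the empty set, where [sup] takes the value 0. *)
have [t0|noT] := pselect (exists t : T, True); last first.
  rewrite (_ : [set _ | _ in _] = set0); first by rewrite sup0 -ler0c MR.
  by rewrite -subset0 => y [t _ _]; apply: noT; exists t.
apply: ge_sup; first by case: t0 => t _; exists (complex.Re `|f t|), t.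
by move=> _ [t _ <-]; rewrite -lecR MR RRe_real ?ger0_real.
Qed.

Lemma le_uspan_norm (f : uspan) t : `|f t| <= uspan_norm f.
Proof.
have fR : (complex.Re `|f t|)%:C = `|f t| by rewrite RRe_real ?ger0_real.
rewrite -fR lecR; apply: sup_upper_bound; last by exists t.
split; first by exists (complex.Re `|f t|), t.
have /asboolP[[M M0 fM] _] := valP f.
exists (complex.Re M) => _ [s _ <-].
by rewrite -lecR !RRe_real ?ger0_real.
Qed.

Lemma uspan_norm_ge0 (f : uspan) : 0 <= uspan_norm f.
Proof.
have [[t _]|noT] := pselect (exists t : T, True).
  exact: le_trans (le_uspan_norm f t).
rewrite /uspan_norm (_ : [set _ | _ in _] = set0); first by rewrite sup0.
by rewrite -subset0 => y [t _ _]; apply: noT; exists t.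
Qed.

Fact uspan_normD f1 f2 : uspan_norm (f1 + f2) <= uspan_norm f1 + uspan_norm f2.
Proof.
apply: uspan_norm_le => [|t]; first by rewrite addr_ge0 // uspan_norm_ge0.
by rewrite uspanD (le_trans (ler_normD _ _)) // lerD // le_uspan_norm.
Qed.

Fact uspan_normZ c f : uspan_norm (c *: f) = `|c| * uspan_norm f.
Proof.
have le c' f' : uspan_norm (c' *: f') <= `|c'| * uspan_norm f'.
  apply: uspan_norm_le => [|t]; first by rewrite mulr_ge0 // uspan_norm_ge0.
  by rewrite uspanZ normrM ler_wpM2l // le_uspan_norm.
apply/eqP; rewrite eq_le le /=.
have [->|c0] := eqVneq c 0; first by rewrite normr0 mul0r uspan_norm_ge0.
rewrite -ler_pdivlMl ?normr_gt0 // -normfV.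
by rewrite -[X in uspan_norm X <= _](scalerK c0) le.
Qed.

Fact uspan_norm0_eq0 f : uspan_norm f = 0 -> f = 0.
Proof.
move=> f0; apply: uspanP => t; apply/eqP.
by rewrite uspan0 -normr_le0 -f0 le_uspan_norm.
Qed.

HB.instance Definition _ := Lmodule_isNormed.Build K uspan
  uspan_normD uspan_normZ uspan_norm0_eq0.

Lemma uspan_normP (f : uspan) (M : K) :
  0 <= M -> (forall t, `|f t| <= M) -> `|f| <= M.
Proof. exact: uspan_norm_le. Qed.

Lemma ler_uspan_norm (f : uspan) t : `|f t| <= `|f|.
Proof. exact: le_uspan_norm. Qed.

(** Pointwise limits exist, and the Cauchy estimates do not depend on the point, so the convergence
    is uniform; a uniform limit is again bounded and approximable by finite sums. *)
Fact uspan_complete (F : set_system uspan) : ProperFilter F -> cauchy F -> cvg F.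
Proof.
move=> FF /cauchyP Fc.
have lim_t t : exists l, forall e : K, 0 < e -> F [set f : uspan | `|l - f t| <= e].
  have [//|l Fl] := @complex_complete R ((fun f : uspan => f t) @ F) _.
    move=> e e0; have [f Ff] := Fc _ e0; exists (f t).
    rewrite /fmap /=; apply: filterS Ff => h; rewrite -ball_normE /= => fh.
    by rewrite -uspanB; apply: le_lt_trans fh; apply: ler_uspan_norm.
  by exists l.
pose l t := sval (cid (lim_t t)).
have lP t (e : K) : 0 < e -> F [set f : uspan | `|l t - f t| <= e].
  exact: (svalP (cid (lim_t t))).
have near_l (e : K) : 0 < e -> exists2 f : uspan,
    F (ball f e) & forall t, `|l t - f t| <= e.
  move=> e0; have [f Ff] := Fc _ e0; exists f => // t.
  apply/ler_addgt0Pr => d d0.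
  have [h [fh lh]] := filter_ex (filterI Ff (lP t _ d0)).
  rewrite -[l t](subrK (h t)) -addrA (le_trans (ler_normD _ _)) // [leRHS]addrC.
  apply: lerD; first exact: lh.
  rewrite distrC -uspanB (le_trans (ler_uspan_norm _ _)) // ltW //.
have lin_l : l \in in_uspan.
  apply/asboolP; split.
    have [f _ fl] := near_l 1 ltr01.
    exists (1 + `|f|) => [|t]; first by rewrite addr_ge0.
    rewrite -[l t](subrK (f t)) (le_trans (ler_normD _ _)) // lerD //.
    exact: ler_uspan_norm.
  move=> e e0; have e20 : 0 < e / 2 by rewrite divr_gt0.
  have [f _ fl] := near_l _ e20.
  have /asboolP[_ /(_ _ e20)[a fa]] := valP f.
  exists a => t; rewrite -[l t](subrK (f t)) -addrA.
  by rewrite (le_trans (ler_normD _ _)) // [leRHS]splitr lerD.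
apply/cvg_ex; exists (Uspan lin_l); apply/cvgrPdist_le => /= e e0.
have e20 : 0 < e / 2 by rewrite divr_gt0.
have [f Ff fl] := near_l _ e20.
apply: filterS Ff => h; rewrite -ball_normE /= => fh.
rewrite -[Uspan _](subrK f) -addrA (le_trans (ler_normD _ _)) //.
rewrite [leRHS]splitr lerD //; last exact: ltW.
by apply: uspan_normP => [|t]; [exact: ltW|rewrite uspanB].
Qed.

HB.instance Definition _ := Uniform_isComplete.Build uspan uspan_complete.

End UniformSpan.

Section UniformSpanEmbedding.
Variables (R : realType) (X T : Type) (g : X -> T -> R[i]).
Notation K := R[i].
Hypothesis g1 : forall x t, `|g x t| <= 1.

Lemma lin_in_uspan (a : seq (K * X)) : (fun t => lin (g^~ t) a) \in in_uspan g.
Proof.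
apply/asboolP; split; last first.
  by move=> e e0; exists a => t; rewrite subrr normr0 ltW.
exists (\sum_(p <- a) `|p.1|) => [|t]; first exact: sumr_ge0.
rewrite (le_trans (ler_norm_sum _ _ _)) // ler_sum // => p _.
by rewrite normrM ler_piMr.
Qed.

Definition emb a : uspan g := Uspan (lin_in_uspan a).

Lemma embE a t : emb a t = lin (g^~ t) a. Proof. by []. Qed.

Lemma emb_dense (f : uspan g) (e : K) : 0 < e -> exists a, `|f - emb a| <= e.
Proof.
move=> e0; have /asboolP[_ /(_ _ e0)[a fa]] := valP f; exists a.
by apply: uspan_normP => [|t]; [exact: ltW|rewrite uspanB; exact: fa].
Qed.

End UniformSpanEmbedding.

(** The restriction to [e <= 1] lets applications absorb terms quadratic in [e] into the linear
    error. *)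
Lemma ler_addM_arbitrarily_small (K : numFieldType) (x y C : K) : 0 <= C ->
  (forall e : K, 0 < e -> e <= 1 -> x <= y + C * e) -> x <= y.
Proof.
move=> C0 xC; apply/ler_addgt0Pr => e e0.
have C1 : 0 < C + 1 by rewrite ltr_wpDl.
have eC : 0 < e / (C + 1) by rewrite divr_gt0.
have [le1|lt1] := comparable_leP (real_comparable (gtr0_real eC) (@real1 K)).
  rewrite (le_trans (xC _ eC le1)) // lerD2l mulrA ler_pdivrMr // mulrC.
  by rewrite ler_wpM2l ?lerDl // ltW.
rewrite (le_trans (xC 1 ltr01 (lexx 1))) // lerD2l mulr1 ltW //.
move: lt1; rewrite ltr_pdivlMr // mul1r; apply: le_lt_trans.
by rewrite lerDl.
Qed.

Lemma norm_arbitrarily_small (K : numFieldType) (V : normedZmodType K) (x : V) (C : K) :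
  0 <= C -> (forall e : K, 0 < e -> e <= 1 -> `|x| <= C * e) -> x = 0.
Proof.
move=> C0 xC; apply/eqP; rewrite -normr_le0.
by apply: (ler_addM_arbitrarily_small C0) => e e0 e1; rewrite add0r xC.
Qed.

(* With centres phi a and radii M * |f - a|, this defines the value at f of    *)
(* the extension of an M-Lipschitz map phi given on a dense set.               *)
Lemma touching_balls (K : numFieldType) (B : completeNormedModType K) (J : Type)
    (phi : J -> B) (r : J -> K) :
  (forall i j, `|phi i - phi j| <= r i + r j) ->
  (forall e, 0 < e -> exists i, r i <= e) ->
  exists h, forall i, `|h - phi i| <= r i.
Proof.
move=> phir r0.
pose F := filter_from [set e : K | 0 < e] (fun e => phi @` [set i | r i <= e]).
have FF : ProperFilter F.
  apply: filter_from_proper.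
    apply: filter_from_filter; first by exists 1 => /=.
    move=> d e /= d0 e0.
    have [de|ed] := comparable_leP (real_comparable (gtr0_real d0) (gtr0_real e0)).
      exists d => // _ [i ri <-]; split; exists i => //=.
      exact: le_trans de.
    exists e => // _ [i ri <-]; split; exists i => //=.
    exact: le_trans (ltW ed).
  by move=> e /= /r0 [i ri]; exists (phi i), i.
have : cauchy F.
  apply/cauchy_exP => e e0; have e30 : 0 < e / 2 / 2 by rewrite !divr_gt0.
  have [i ri] := r0 _ e30; exists (phi i), (e / 2 / 2) => // _ [j rj <-].
  rewrite -ball_normE /=; apply: le_lt_trans (phir i j) _.
  apply: le_lt_trans (lerD ri rj) _.
  by rewrite -splitr ltr_pdivrMr // ltr_pMr // ltr1n.
move/cauchy_cvg => /cvg_ex [h Fh]; exists h => i.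
apply/ler_addgt0Pr => e e0; have e20 : 0 < e / 2 by rewrite divr_gt0.
have [x [hj [j rj jx]]] : exists x, `|h - x| <= e / 2 /\ (phi @` [set i | r i <= e / 2]) x.
  have hF : F (ball h (e / 2)) := Fh _ (nbhsx_ballx h _ e20).
  have FE : F (phi @` [set i | r i <= e / 2]) by exists (e / 2).
  have [x [hx Ex]] := filter_ex (filterI hF FE); exists x; split => //.
  by apply: ltW; move: hx; rewrite -ball_normE.
rewrite -jx in hj.
rewrite -[h](subrK (phi j)) -addrA (le_trans (ler_normD _ _)) //.
rewrite (le_trans (lerD hj (phir j i))) // addrA addrC.
by rewrite lerD // [leRHS]splitr lerD.
Qed.

(** * Extension of bounded maps from finite sums to their uniform limits *)

Section Extension.
Variables (R : realType) (X T : Type) (g : X -> T -> R[i]).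
Notation K := R[i].
Hypothesis g1 : forall x t, `|g x t| <= 1.
Notation A := (uspan g).
Notation E := (emb g1).

Lemma emb_nil : E [::] = 0.
Proof. by apply: uspanP => t; rewrite uspan0 embE lin_nil. Qed.

Lemma emb_cat a b : E (a ++ b) = E a + E b.
Proof. by apply: uspanP => t; rewrite uspanD !embE lin_cat. Qed.

Lemma emb_scale c a : E (lscale c a) = c *: E a.
Proof. by apply: uspanP => t; rewrite uspanZ !embE lin_scale. Qed.

Lemma emb_sub a b : E (a ++ lscale (- 1) b) = E a - E b.
Proof. by rewrite emb_cat emb_scale scaleN1r. Qed.

Lemma emb_cons p a : E (p :: a) = p.1 *: E [:: (1, p.2)] + E a.
Proof.
by apply: uspanP => t; rewrite uspanD uspanZ !embE lin_cons lin1.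
Qed.

(** Extension by density. That [phi a] depends on [E a] only is not assumed: it follows from the
    bound, applied to a difference of sums. The twist [s] covers linear maps, with [idfun], and the
    conjugate-linear star. *)
Lemma emb_ext (B : completeNormedModType K) (s : {rmorphism K -> K})
    (phi : seq (K * X) -> B) (M : K) :
  (forall c, `|s c| = `|c|) -> 0 <= M ->
  (forall a b, phi (a ++ b) = phi a + phi b) ->
  (forall c a, phi (lscale c a) = s c *: phi a) ->
  (forall a, `|phi a| <= M * `|E a|) ->
  exists Phi : A -> B,
    [/\ forall f1 f2, Phi (f1 + f2) = Phi f1 + Phi f2,
        forall c f, Phi (c *: f) = s c *: Phi f,
        forall f, `|Phi f| <= M * `|f|
      & forall a, Phi (E a) = phi a].
Proof.
move=> sn M0 phiD phiZ phiM.
have phiB a b : phi (a ++ lscale (- 1) b) = phi a - phi b.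
  by rewrite phiD phiZ rmorphN1 scaleN1r.
have ex f : exists h, forall a, `|h - phi a| <= M * `|f - E a|.
  apply: touching_balls => [a b|e e0].
    rewrite -phiB (le_trans (phiM _)) // -mulrDr ler_wpM2l // emb_sub.
    by rewrite (distrC f (E a)) ler_distD.
  have M1 : 0 < M + 1 by rewrite ltr_wpDl.
  have [a fa] := emb_dense g1 f (divr_gt0 e0 M1).
  exists a; rewrite (le_trans (ler_wpM2l M0 fa)) //.
  by rewrite mulrA ler_pdivrMr // mulrC ler_wpM2l ?lerDl // ltW.
pose Phi f := sval (cid (ex f)).
have PhiP f a : `|Phi f - phi a| <= M * `|f - E a| := svalP (cid (ex f)) a.
have PhiE a : Phi (E a) = phi a.
  apply/eqP; rewrite -subr_eq0 -normr_le0 (le_trans (PhiP _ _)) //.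
  by rewrite subrr normr0 mulr0.
exists Phi; split => //.
- move=> f1 f2; apply/eqP; rewrite -subr_eq0; apply/eqP.
  apply: (@norm_arbitrarily_small _ _ _ (M * (2 + 2))).
    by rewrite mulr_ge0 // addr_ge0.
  move=> e e0 _; have [a fa] := emb_dense g1 f1 e0; have [b fb] := emb_dense g1 f2 e0.
  have -> : Phi (f1 + f2) - (Phi f1 + Phi f2) =
      (Phi (f1 + f2) - phi (a ++ b)) - ((Phi f1 - phi a) + (Phi f2 - phi b)).
    by rewrite phiD [Phi f1 - _ + _]addrACA -opprD opprB addrA subrK.
  rewrite (le_trans (ler_normB _ _)) // mulrDr mulrDl lerD //.
    rewrite (le_trans (PhiP _ _)) // -mulrA ler_wpM2l // emb_cat opprD addrACA.
    by rewrite (le_trans (ler_normD _ _)) // mulrDl !mul1r lerD.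
  rewrite (le_trans (ler_normD _ _)) // -mulrA mulrDl !mul1r mulrDr lerD //.
    by rewrite (le_trans (PhiP _ _)) // ler_wpM2l.
  by rewrite (le_trans (PhiP _ _)) // ler_wpM2l.
- move=> c f; apply/eqP; rewrite -subr_eq0; apply/eqP.
  apply: (@norm_arbitrarily_small _ _ _ (M * `|c| + `|c| * M)).
    by rewrite addr_ge0 // mulr_ge0.
  move=> e e0 _; have [a fa] := emb_dense g1 f e0.
  have -> : Phi (c *: f) - s c *: Phi f =
      (Phi (c *: f) - phi (lscale c a)) - s c *: (Phi f - phi a).
    by rewrite phiZ scalerBr opprB addrA subrK.
  rewrite (le_trans (ler_normB _ _)) // mulrDl lerD //.
    rewrite (le_trans (PhiP _ _)) // -mulrA ler_wpM2l //.
    by rewrite emb_scale -scalerBr normrZ ler_wpM2l.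
  rewrite normrZ sn -mulrA ler_wpM2l // (le_trans (PhiP _ _)) //.
  by rewrite ler_wpM2l.
- move=> f; apply/ler_addgt0Pr => e e0.
  have M1 : 0 < M + M + 1 by rewrite ltr_wpDl // addr_ge0.
  have [a fa] := emb_dense g1 f (divr_gt0 e0 M1).
  rewrite -[Phi f](subrK (phi a)) (le_trans (ler_normD _ _)) //.
  rewrite (le_trans (lerD (PhiP _ _) (phiM _))) //.
  have Ea : `|E a| <= `|f| + `|f - E a|.
    by have := ler_normB f (f - E a); rewrite subKr.
  rewrite (le_trans (lerD (ler_wpM2l M0 fa) (ler_wpM2l M0 Ea))) //.
  rewrite mulrDr addrCA lerD //.
  rewrite (le_trans (lerD (lexx _) (ler_wpM2l M0 fa))) //.
  rewrite -mulrDl mulrA ler_pdivrMr // mulrC ler_wpM2l ?lerDl //.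
  exact: ltW.
Qed.

(** Additivity instead of linearity admits conjugate-linear maps. Algebraic laws of the completion
    are proved by fixing all variables but one and comparing two such maps on finite sums. *)
Definition bounded_additive (B : normedModType K) (F : A -> B) :=
  (forall f1 f2, F (f1 + f2) = F f1 + F f2) /\
  (exists2 M : K, 0 <= M & forall f, `|F f| <= M * `|f|).

Lemma bounded_additive_eq (B : normedModType K) (F G : A -> B) :
  bounded_additive F -> bounded_additive G ->
  (forall a, F (E a) = G (E a)) -> F =1 G.
Proof.
move=> [FD [M M0 FM]] [GD [N N0 GN]] FG f; apply/eqP; rewrite -subr_eq0; apply/eqP.
apply: (@norm_arbitrarily_small _ _ _ (M + N)) => [|e e0 _]; first exact: addr_ge0.
have [a fa] := emb_dense g1 f e0.
rewrite -[f](subrK (E a)) FD GD FG opprD addrACA subrr addr0.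
rewrite (le_trans (ler_normB _ _)) // mulrDl lerD //.
  by rewrite (le_trans (FM _)) // ler_wpM2l.
by rewrite (le_trans (GN _)) // ler_wpM2l.
Qed.

Lemma bounded_additive_comp (B : normedModType K) (F : A -> B) (G : A -> A) :
  bounded_additive F -> bounded_additive G -> bounded_additive (F \o G).
Proof.
move=> [FD [M M0 FM]] [GD [N N0 GN]]; split=> [f1 f2|] /=; first by rewrite GD FD.
exists (M * N) => [|f]; first exact: mulr_ge0.
by rewrite (le_trans (FM _)) // -mulrA ler_wpM2l.
Qed.

End Extension.

(** * The twisted group algebra of an abelian group *)

(** Such a map is a normalized 2-cocycle; bimultiplicativity moreover turns the inversion of an
    argument into complex conjugation, which keeps the formulas for the star explicit. *)
Record bicharacter (R : realType) (X : zmodType) := Bicharacter {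
  bichar :> X -> X -> R[i];
  bicharDl : forall x y z, bichar (x + y) z = bichar x z * bichar y z;
  bicharDr : forall x y z, bichar x (y + z) = bichar x y * bichar x z;
  bichar_norm : forall x y, `|bichar x y| = 1
}.

Section Bicharacter.
Variables (R : realType) (X : zmodType) (w : bicharacter R X).

Lemma bichar_neq0 x y : w x y != 0.
Proof. by rewrite -normr_gt0 bichar_norm. Qed.

Lemma bicharK x y : w x y * Num.conj (w x y) = 1.
Proof. by rewrite -normCK bichar_norm expr1n. Qed.

Lemma bichar0l x : w 0 x = 1.
Proof.
by apply: (mulfI (bichar_neq0 0 x)); rewrite -bicharDl addr0 mulr1.
Qed.

Lemma bichar0r x : w x 0 = 1.
Proof.
by apply: (mulfI (bichar_neq0 x 0)); rewrite -bicharDr addr0 mulr1.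
Qed.

Lemma bicharNl x y : w (- x) y = Num.conj (w x y).
Proof.
by apply: (mulfI (bichar_neq0 x y)); rewrite -bicharDl subrr bichar0l bicharK.
Qed.

Lemma bicharNr x y : w x (- y) = Num.conj (w x y).
Proof.
by apply: (mulfI (bichar_neq0 x y)); rewrite -bicharDr subrr bichar0r bicharK.
Qed.

End Bicharacter.

Section FormalSums.
Variables (R : realType) (X : zmodType) (w : bicharacter R X).
Notation K := R[i].
Notation L := (seq (K * X)).
Implicit Types (a b c : L) (x y z : X).

Definition delta x : L := [:: (1, x)].

Definition lmul a b : L :=
  [seq (p.1 * q.1 * w p.2 q.2, p.2 + q.2) | p <- a, q <- b].

(** For canonical unitaries, [u_x u_(-x) = w x (- x) = conj (w x x)], so the inverse of [u_x] is
    [w x x *: u_(-x)]. *)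
Definition lstar a : L := [seq (Num.conj p.1 * w p.2 p.2, - p.2) | p <- a].

Section LinMul.
Variables (V : lmodType K) (h : X -> V).

Lemma lin_delta x : lin h (delta x) = h x.
Proof. exact: lin1. Qed.

Lemma lin_mulE a b : lin h (lmul a b) =
  \sum_(p <- a) \sum_(q <- b) (p.1 * q.1 * w p.2 q.2) *: h (p.2 + q.2).
Proof. by rewrite /lin /lmul big_allpairs_dep. Qed.

Lemma lin_mul a b :
  lin h (lmul a b) = lin (fun x => lin h (lmul (delta x) b)) a.
Proof.
rewrite lin_mulE; apply: eq_bigr => p _; rewrite lin_mulE big_seq1 scaler_sumr.
by apply: eq_bigr => q _ /=; rewrite scalerA mul1r mulrA.
Qed.

Lemma lin_mulA a b c : lin h (lmul (lmul a b) c) = lin h (lmul a (lmul b c)).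
Proof.
rewrite lin_mulE /lmul big_allpairs_dep lin_mulE /=.
apply: eq_bigr => p _; rewrite big_allpairs_dep /=.
apply: eq_bigr => q _; apply: eq_bigr => r _ /=.
rewrite addrA bicharDl bicharDr; congr (_ *: _).
ring.
Qed.

Lemma lin_mul1l a : lin h (lmul (delta 0) a) = lin h a.
Proof.
rewrite lin_mulE big_seq1; apply: eq_bigr => q _ /=.
by rewrite bichar0l mul1r mulr1 add0r.
Qed.

Lemma lin_mul1r a : lin h (lmul a (delta 0)) = lin h a.
Proof.
rewrite lin_mulE; apply: eq_bigr => q _ /=.
by rewrite big_seq1 /= bichar0r !mulr1 addr0.
Qed.

Lemma lin_mulDl a b c :
  lin h (lmul (a ++ b) c) = lin h (lmul a c) + lin h (lmul b c).
Proof. by rewrite !lin_mulE big_cat. Qed.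

Lemma lin_mulDr a b c :
  lin h (lmul a (b ++ c)) = lin h (lmul a b) + lin h (lmul a c).
Proof.
by rewrite !lin_mulE -big_split; apply: eq_bigr => p _ /=; rewrite big_cat.
Qed.

Lemma lin_mulZl k a b : lin h (lmul (lscale k a) b) = k *: lin h (lmul a b).
Proof.
rewrite !lin_mulE big_map scaler_sumr; apply: eq_bigr => p _.
rewrite scaler_sumr; apply: eq_bigr => q _ /=.
by rewrite scalerA !mulrA.
Qed.

Lemma lin_mulZr k a b : lin h (lmul a (lscale k b)) = k *: lin h (lmul a b).
Proof.
rewrite !lin_mulE scaler_sumr; apply: eq_bigr => p _.
rewrite big_map scaler_sumr; apply: eq_bigr => q _ /=.
by rewrite scalerA !mulrA (mulrC k).
Qed.

Lemma lin_mul_delta x y : lin h (lmul (delta x) (delta y)) = w x y *: h (x + y).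
Proof. by rewrite lin_mulE !big_seq1 /= mul1r mul1r. Qed.

Lemma lin_star_delta x : lin h (lmul (lstar (delta x)) (delta x)) = h 0.
Proof.
rewrite lin_mulE !big_seq1 /= conjC1 mul1r mulr1 bicharNl bicharK.
by rewrite addNr scale1r.
Qed.

Lemma lin_delta_star x : lin h (lmul (delta x) (lstar (delta x))) = h 0.
Proof.
rewrite lin_mulE !big_seq1 /= conjC1 !mul1r bicharNr bicharK.
by rewrite subrr scale1r.
Qed.

Lemma lin_starE a :
  lin h (lstar a) = \sum_(p <- a) (Num.conj p.1 * w p.2 p.2) *: h (- p.2).
Proof. by rewrite /lin big_map. Qed.

Lemma lin_starK a : lin h (lstar (lstar a)) = lin h a.
Proof.
rewrite lin_starE big_map; apply: eq_bigr => p _ /=.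
rewrite opprK rmorphM /= conjCK bicharNl bicharNr conjCK.
by rewrite -mulrA [_ * w _ _]mulrC bicharK mulr1.
Qed.

Lemma lin_starD a b : lin h (lstar (a ++ b)) = lin h (lstar a) + lin h (lstar b).
Proof. by rewrite !lin_starE big_cat. Qed.

Lemma lin_starZ k a : lin h (lstar (lscale k a)) = Num.conj k *: lin h (lstar a).
Proof.
rewrite !lin_starE big_map scaler_sumr; apply: eq_bigr => p _ /=.
by rewrite scalerA rmorphM mulrA.
Qed.

Lemma lin_starM a b : lin h (lstar (lmul a b)) = lin h (lmul (lstar b) (lstar a)).
Proof.
rewrite lin_starE /lmul big_allpairs_dep lin_mulE /= big_map exchange_big /=.
apply: eq_bigr => q _; rewrite big_map; apply: eq_bigr => p _ /=.
rewrite opprD [- p.2 + _]addrC; congr (_ *: _).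
rewrite !bicharDl !bicharDr !bicharNl !bicharNr conjCK !rmorphM /=.
set wpq := w p.2 q.2; set wqp := w q.2 p.2.
transitivity (Num.conj q.1 * w q.2 q.2 * (Num.conj p.1 * w p.2 p.2) * wqp *
   (wpq * Num.conj wpq)); last by rewrite bicharK mulr1.
ring.
Qed.

End LinMul.
End FormalSums.

(** * The square-summable inner product on finite formal sums *)

Section InnerProduct.
Variables (R : realType) (X : zmodType).
Notation K := R[i].
Notation L := (seq (K * X)).
Implicit Types (a b c : L) (x y z : X).

Definition coef a x : K := \sum_(p <- a) p.1 * (p.2 == x)%:R.

(** Only an upper bound for the true support: points whose coefficients cancel remain listed. *)
Definition supp a : seq X := undup (unzip2 a).

Definition ip a b : K := \sum_(p <- a) Num.conj p.1 * coef b p.2.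

Lemma lin_supp (V : lmodType K) (h : X -> V) a :
  lin h a = \sum_(x <- supp a) coef a x *: h x.
Proof.
under eq_bigr do rewrite scaler_suml.
rewrite exchange_big /= /lin big_seq [RHS]big_seq; apply: eq_bigr => p pa.
rewrite (bigD1_seq p.2) ?undup_uniq //=; last by rewrite mem_undup map_f.
rewrite eqxx mulr1 big1 ?addr0 // => x xp.
by rewrite eq_sym (negbTE xp) mulr0 scale0r.
Qed.

Lemma coef_notin a x : x \notin supp a -> coef a x = 0.
Proof.
rewrite mem_undup => xa; rewrite /coef big_seq big1 // => p pa.
by case: eqP => [px|]; rewrite ?mulr0 //; case/negP: xa; rewrite -px map_f.
Qed.

Lemma ip_lin a b : ip a b = lin (fun y => ip a (delta R y)) b.
Proof.
rewrite /ip /lin /coef; under [RHS]eq_bigr do rewrite scaler_sumr.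
rewrite [RHS]exchange_big /=; apply: eq_bigr => p _.
rewrite mulr_sumr; apply: eq_bigr => q _.
by rewrite big_seq1 /= mul1r mulrCA.
Qed.

Lemma ip_conj a b : ip b a = Num.conj (ip a b).
Proof.
rewrite /ip rmorph_sum /coef /=; under eq_bigr do rewrite mulr_sumr.
rewrite exchange_big /=; apply: eq_bigr => p _.
rewrite rmorphM /= conjCK rmorph_sum mulr_sumr; apply: eq_bigr => q _ /=.
by rewrite rmorphM /= conjC_nat eq_sym; ring.
Qed.

Lemma ip_catr a b c : ip a (b ++ c) = ip a b + ip a c.
Proof. by rewrite !(ip_lin a) lin_cat. Qed.

Lemma ip_scaler k a b : ip a (lscale k b) = k * ip a b.
Proof. by rewrite !(ip_lin a) lin_scale. Qed.

Lemma ip_catl a b c : ip (a ++ b) c = ip a c + ip b c.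
Proof. exact: big_cat. Qed.

Lemma ip_scalel k a b : ip (lscale k a) b = Num.conj k * ip a b.
Proof.
rewrite /ip big_map mulr_sumr; apply: eq_bigr => p _ /=.
by rewrite rmorphM mulrA.
Qed.

Lemma ip_supp a b : ip a b = \sum_(x <- supp a) Num.conj (coef a x) * coef b x.
Proof.
have := lin_supp (fun x => Num.conj (coef b x) : K) a.
move=> /(congr1 Num.conj); rewrite /lin !rmorph_sum /= => H.
rewrite /ip; transitivity (\sum_(i <- a) Num.conj (i.1 * Num.conj (coef b i.2)));
  first by apply: eq_bigr => p _; rewrite rmorphM /= conjCK.
by rewrite H; apply: eq_bigr => x _; rewrite rmorphM /= conjCK.
Qed.

Lemma ip_diag a : ip a a = \sum_(x <- supp a) `|coef a x| ^+ 2.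
Proof. by rewrite ip_supp; apply: eq_bigr => x _; rewrite normCKC. Qed.

Lemma ip_ge0 a : 0 <= ip a a.
Proof. by rewrite ip_diag sumr_ge0 // => x _; rewrite exprn_ge0. Qed.

Lemma ip_eq0 a b : ip b b = 0 -> ip a b = 0.
Proof.
rewrite ip_diag => /eqP; rewrite psumr_eq0; last by move=> x _; rewrite exprn_ge0.
move=> /allP b0; rewrite /ip big1 // => p _.
suff -> : coef b p.2 = 0 by rewrite mulr0.
have [pb|/coef_notin//] := boolP (p.2 \in supp b).
by have := b0 _ pb; rewrite sqrf_eq0 normr_eq0 => /eqP.
Qed.

Lemma ip_cauchy_schwarz a b : `|ip a b| ^+ 2 <= ip a a * ip b b.
Proof.
have [b0|b0] := eqVneq (ip b b) 0.
  by rewrite (ip_eq0 _ b0) normr0 expr0n mulr_ge0 ?ip_ge0.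
have bp : 0 < ip b b by rewrite lt0r b0 ip_ge0.
have bR : Num.conj (ip b b) = ip b b by rewrite -ip_conj.
(* Positivity at the vector [ip b b * a - ip b a * b], the rescaled component of [a] orthogonal to
   [b]; a factor [ip b b] then divides out. *)
have := ip_ge0 (lscale (ip b b) a ++ lscale (- ip b a) b).
rewrite !ip_catr !ip_catl !ip_scaler !ip_scalel rmorphN /= bR -!(ip_conj b a).
have -> : `|ip a b| ^+ 2 = ip a b * ip b a by rewrite normCK -ip_conj.
set u := ip a b; set v := ip b a; set g := ip b b; set e := ip a a.
have -> : g * (g * e) + g * (- u * v) + (- v * (g * u) + - v * (- u * g)) =
  g * (e * g - u * v) by ring.
by rewrite pmulr_rge0 // subr_ge0.
Qed.

Definition nrm2 a : K := sqrtC (ip a a).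

Lemma nrm2_ge0 a : 0 <= nrm2 a.
Proof. by rewrite sqrtC_ge0 ip_ge0. Qed.

Lemma nrm2K a : nrm2 a ^+ 2 = ip a a.
Proof. exact: sqrtCK. Qed.

Lemma ip_le a b : `|ip a b| <= nrm2 a * nrm2 b.
Proof.
rewrite -(@ler_pXn2r _ 2) ?nnegrE ?mulr_ge0 ?nrm2_ge0 //.
by rewrite exprMn !nrm2K ip_cauchy_schwarz.
Qed.

Lemma ip_delta x a : ip (delta R x) a = coef a x.
Proof. by rewrite /ip big_seq1 /= conjC1 mul1r. Qed.

Lemma nrm2_delta x : nrm2 (delta R x) = 1.
Proof. by rewrite /nrm2 ip_delta /coef big_seq1 eqxx mulr1 sqrtC1. Qed.

Variable w : bicharacter R X.

Lemma ip_lmulE a b c :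
  ip c (lmul w a b) = lin (fun x => ip c (lmul w (delta R x) b)) a.
Proof.
rewrite ip_lin lin_mul; apply: eq_bigr => p _; congr (_ *: _).
by rewrite [in RHS]ip_lin.
Qed.

Lemma ip_adj a b c : ip (lmul w a b) c = ip b (lmul w (lstar w a) c).
Proof.
rewrite [RHS]ip_lin lin_mulE /ip big_map /lmul big_allpairs_dep /=.
apply: eq_bigr => p _; rewrite /coef.
under eq_bigr do rewrite mulr_sumr.
rewrite exchange_big /=; apply: eq_bigr => r _.
rewrite scaler_sumr; apply: eq_bigr => q _ /=.
rewrite big_seq1 mul1r /= /GRing.scale /= !rmorphM /=.
(* Only [r.2 = p.2 + q.2] contributes. There [w (- p.2) r.2] is the conjugate of
   [w p.2 p.2 * w p.2 q.2], and its first factor cancels the phase built into [lstar]. *)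
have [->|rpq] := eqVneq r.2 (p.2 + q.2).
  rewrite addKr eqxx bicharNl bicharDr rmorphM /=.
  transitivity (Num.conj p.1 * Num.conj q.1 * Num.conj (w p.2 q.2) * r.1 *
     (w p.2 p.2 * Num.conj (w p.2 p.2))); last by ring.
  by rewrite bicharK; ring.
rewrite (_ : _ == q.2 = false) ?mulr0 //.
by apply/eqP => qE; case/eqP: rpq; rewrite -qE addrA subrr add0r.
Qed.

Lemma nrm2_lmul_delta x b : nrm2 (lmul w (delta R x) b) = nrm2 b.
Proof.
rewrite /nrm2 ip_adj; congr sqrtC; rewrite [LHS]ip_lin -lin_mulA lin_mul.
by rewrite lin_star_delta lin_mul1l -ip_lin.
Qed.

End InnerProduct.

(** * The completion in the regular norm as a C*-algebra *)

Section TwistedGroupAlgebra.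
Variables (R : realType) (X : zmodType) (w : bicharacter R X).
Notation K := R[i].
Notation L := (seq (K * X)).
Implicit Types (a b : L) (x y z : X).

(* The matrix coefficients of the left regular representation at normalized    *)
(* vectors; when a vector has norm 0 the value is 0, since x / 0 = 0.          *)
Definition mcoef x (t : L * L) : K :=
  ip t.2 (lmul w (delta R x) t.1) / (nrm2 t.1 * nrm2 t.2).

Lemma ip_lmul_delta_le x b c : `|ip c (lmul w (delta R x) b)| <= nrm2 b * nrm2 c.
Proof. by rewrite mulrC -(nrm2_lmul_delta w x b) ip_le. Qed.

Lemma mcoef_le1 x t : `|mcoef x t| <= 1.
Proof.
rewrite normrM normfV [X in _ / X]ger0_norm ?mulr_ge0 ?nrm2_ge0 //.
have [->|n0] := eqVneq (nrm2 t.1 * nrm2 t.2) 0; first by rewrite invr0 mulr0.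
rewrite ler_pdivrMr ?mul1r ?ip_lmul_delta_le //.
by rewrite lt0r n0 mulr_ge0 ?nrm2_ge0.
Qed.

Definition tga := uspan mcoef.
HB.instance Definition _ := CompleteNormedModule.on tga.
Implicit Types f g h : tga.

Definition tg a : tga := emb mcoef_le1 a.

Lemma tgE a t : tg a t = ip t.2 (lmul w a t.1) / (nrm2 t.1 * nrm2 t.2).
Proof.
rewrite /tg embE ip_lmulE /lin mulr_suml; apply: eq_bigr => p _.
by rewrite /mcoef /GRing.scale /= mulrA.
Qed.

Lemma tg_lin a b : (forall h : X -> K, lin h a = lin h b) -> tg a = tg b.
Proof. by move=> ab; apply: uspanP => t; rewrite /tg !embE ab. Qed.

Lemma ip_lmul_le a b c : `|ip c (lmul w a b)| <= `|tg a| * nrm2 b * nrm2 c.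
Proof.
rewrite -mulrA; have [n0|n0] := eqVneq (nrm2 b * nrm2 c) 0; last first.
  have np : 0 < nrm2 b * nrm2 c by rewrite lt0r n0 mulr_ge0 ?nrm2_ge0.
  rewrite -ler_pdivrMr // (_ : _ / _ = `|tg a (b, c)|); first exact: ler_uspan_norm.
  by rewrite tgE normrM normfV [X in _ = _ / X]ger0_norm // ltW.
(* At a null vector [mcoef] is 0 by convention and carries no information; Cauchy-Schwarz shows that
   each monomial contributes 0. *)
rewrite n0 mulr0 ip_lmulE normr_le0; apply/eqP.
rewrite /lin big1 // => p _.
suff -> : ip c (lmul w (delta R p.2) b) = 0 by rewrite scaler0.
by apply/eqP; rewrite -normr_le0 -n0 ip_lmul_delta_le.
Qed.

(** Together with [ip_lmul_le], this identifies [|tg w a|] with the operator norm of left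
    multiplication by [a] on finitely supported vectors. *)
Lemma tg_norm_le a (M : K) : 0 <= M ->
  (forall b c, `|ip c (lmul w a b)| <= M * nrm2 b * nrm2 c) -> `|tg a| <= M.
Proof.
move=> M0 aM; apply: uspan_normP => // t; rewrite tgE normrM normfV.
rewrite [X in _ / X]ger0_norm ?mulr_ge0 ?nrm2_ge0 //.
have [->|n0] := eqVneq (nrm2 t.1 * nrm2 t.2) 0; first by rewrite invr0 mulr0.
rewrite ler_pdivrMr ?mulrA ?aM //.
by rewrite lt0r n0 mulr_ge0 ?nrm2_ge0.
Qed.

Lemma nrm2_lmul_le a b : nrm2 (lmul w a b) <= `|tg a| * nrm2 b.
Proof.
have [->|n0] := eqVneq (nrm2 (lmul w a b)) 0.
  by rewrite mulr_ge0 ?nrm2_ge0.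
have np : 0 < nrm2 (lmul w a b) by rewrite lt0r n0 nrm2_ge0.
rewrite -(ler_pM2r np) (le_trans _ (ip_lmul_le _ _ _)) //.
by rewrite ger0_norm ?ip_ge0 // -nrm2K expr2.
Qed.

Lemma nrm2_le a : nrm2 a <= `|tg a|.
Proof.
have := nrm2_lmul_le a (delta R 0); rewrite nrm2_delta mulr1.
rewrite {1}/nrm2 ip_lin lin_mul1r -ip_lin ip_conj ip_lin lin_mul1r -ip_lin.
by rewrite -ip_conj.
Qed.

Lemma tg_norm_star a : `|tg (lstar w a)| <= `|tg a|.
Proof.
apply: tg_norm_le => // b c; rewrite -ip_adj (le_trans (ip_le _ _)) //.
by rewrite mulrAC ler_wpM2r ?nrm2_ge0 ?nrm2_lmul_le.
Qed.

Lemma tg_normM a b : `|tg (lmul w a b)| <= `|tg a| * `|tg b|.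
Proof.
apply: tg_norm_le => [|c d]; first exact: mulr_ge0.
rewrite ip_lin lin_mulA -ip_lin (le_trans (ip_lmul_le _ _ _)) //.
rewrite ler_wpM2r ?nrm2_ge0 // -mulrA ler_wpM2l //.
exact: nrm2_lmul_le.
Qed.

(** The usual Hilbert space argument: the squared norm of [a b] is the inner product of [b] with
    [star a * a * b], because [lstar] is the adjoint ([ip_adj]). *)
Lemma tg_normE a : `|tg a| ^+ 2 <= `|tg (lmul w (lstar w a) a)|.
Proof.
set N := `|tg (lmul _ _ _)|; have N0 : 0 <= N by exact: normr_ge0.
rewrite -[N]sqrtCK ler_pXn2r ?nnegrE ?sqrtC_ge0 //.
apply: tg_norm_le => [|b c]; first by rewrite sqrtC_ge0.
rewrite -(@ler_pXn2r _ 2) ?nnegrE ?mulr_ge0 ?sqrtC_ge0 ?ip_ge0 //.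
rewrite (le_trans (ip_cauchy_schwarz _ _)) // !exprMn sqrtCK !nrm2K mulrC.
rewrite ler_wpM2r ?ip_ge0 // -[leLHS]ger0_norm ?ip_ge0 //.
rewrite ip_adj ip_lin -lin_mulA -ip_lin (le_trans (ip_lmul_le _ _ _)) //.
by rewrite -mulrA -expr2 nrm2K.
Qed.

Fact lmul_ext a : exists F : tga -> tga,
  [/\ forall f g, F (f + g) = F f + F g, forall c f, F (c *: f) = c *: F f,
      forall f, `|F f| <= `|tg a| * `|f| & forall b, F (tg b) = tg (lmul w a b)].
Proof.
apply: (@emb_ext _ _ _ _ mcoef_le1 tga idfun (fun b => tg (lmul w a b)) `|tg a|) => //.
- by move=> b c; apply: uspanP => t; rewrite uspanD /tg !embE lin_mulDr.
- by move=> k b; apply: uspanP => t; rewrite uspanZ /tg !embE lin_mulZr.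
- exact: tg_normM.
Qed.

Definition lmul_op a : tga -> tga := sval (cid (lmul_ext a)).

Lemma lmul_opP a :
  [/\ forall f g, lmul_op a (f + g) = lmul_op a f + lmul_op a g,
      forall c f, lmul_op a (c *: f) = c *: lmul_op a f,
      forall f, `|lmul_op a f| <= `|tg a| * `|f|
    & forall b, lmul_op a (tg b) = tg (lmul w a b)].
Proof. exact: (svalP (cid (lmul_ext a))). Qed.

Lemma lmul_op_bounded a : bounded_additive (lmul_op a).
Proof. by have [D _ M _] := lmul_opP a; split => //; exists `|tg a|. Qed.

(** The product is extended one factor at a time: [lmul_op] has extended the right factor for a
    fixed finite sum on the left, and the bound on [lmul_op a g] now allows the left factor to be
    extended. *)
Fact mul_ext g : exists F : tga -> tga,
  [/\ forall f1 f2, F (f1 + f2) = F f1 + F f2, forall c f, F (c *: f) = c *: F f,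
      forall f, `|F f| <= `|g| * `|f| & forall a, F (tg a) = lmul_op a g].
Proof.
apply: (@emb_ext _ _ _ _ mcoef_le1 tga idfun (fun a => lmul_op a g) `|g|) => //.
- move=> a b; move: g; apply: (bounded_additive_eq (g1 := mcoef_le1)).
  + exact: lmul_op_bounded.
  + have [aD [M M0 aM]] := lmul_op_bounded a.
    have [bD [N N0 bN]] := lmul_op_bounded b.
    split=> [f1 f2|]; first by rewrite aD bD addrACA.
    exists (M + N) => [|f]; first exact: addr_ge0.
    by rewrite (le_trans (ler_normD _ _)) // mulrDl lerD.
  + move=> c; have [_ _ _ ->] := lmul_opP (a ++ b).
    have [_ _ _ ->] := lmul_opP a; have [_ _ _ ->] := lmul_opP b.
    by apply: uspanP => t; rewrite uspanD /tg !embE lin_mulDl.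
- move=> k a; move: g; apply: (bounded_additive_eq (g1 := mcoef_le1)).
  + exact: lmul_op_bounded.
  + have [aD [M M0 aM]] := lmul_op_bounded a.
    split=> [f1 f2|]; first by rewrite aD scalerDr.
    exists (`|k| * M) => [|f]; first exact: mulr_ge0.
    by rewrite normrZ -mulrA ler_wpM2l.
  + move=> c; have [_ _ _ ->] := lmul_opP (lscale k a).
    have [_ _ _ ->] := lmul_opP a.
    by apply: uspanP => t; rewrite uspanZ /tg !embE lin_mulZl.
- by move=> a; have [_ _ M _] := lmul_opP a; rewrite mulrC.
Qed.

Definition tmul f g : tga := sval (cid (mul_ext g)) f.

Lemma tmulDl : left_distributive tmul +%R.
Proof. by move=> f1 f2 g; have [D _ _ _] := svalP (cid (mul_ext g)); exact: D. Qed.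

Lemma tmulZl c f g : c *: tmul f g = tmul (c *: f) g.
Proof. by have [_ Z _ _] := svalP (cid (mul_ext g)); rewrite /tmul Z. Qed.

Lemma tmul_norm f g : `|tmul f g| <= `|f| * `|g|.
Proof. by have [_ _ M _] := svalP (cid (mul_ext g)); rewrite mulrC; exact: M. Qed.

Lemma tmul_tgl a g : tmul (tg a) g = lmul_op a g.
Proof. by have [_ _ _ E] := svalP (cid (mul_ext g)); exact: E. Qed.

Lemma tmul_tg a b : tmul (tg a) (tg b) = tg (lmul w a b).
Proof. by rewrite tmul_tgl; have [_ _ _ ->] := lmul_opP a. Qed.

Lemma tga_eq (B : normedModType K) (F G : tga -> B) :
  bounded_additive F -> bounded_additive G ->
  (forall a, F (tg a) = G (tg a)) -> F =1 G.
Proof. exact: bounded_additive_eq. Qed.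

Lemma tmul_boundedl g : bounded_additive (tmul^~ g).
Proof.
split=> [f1 f2|]; first exact: tmulDl.
by exists `|g| => // f; rewrite mulrC tmul_norm.
Qed.

Lemma tmulDr : right_distributive tmul +%R.
Proof.
move=> f g1 g2; move: f; apply: tga_eq; first exact: tmul_boundedl.
  have [aD [M M0 aM]] := tmul_boundedl g1.
  have [bD [N N0 bN]] := tmul_boundedl g2.
  split=> [f1 f2|]; first by rewrite aD bD addrACA.
  exists (M + N) => [|f]; first exact: addr_ge0.
  by rewrite (le_trans (ler_normD _ _)) // mulrDl lerD.
by move=> a; rewrite !tmul_tgl; have [D _ _ _] := lmul_opP a; exact: D.
Qed.

Lemma tmul_boundedr f : bounded_additive (tmul f).
Proof.
split=> [g1 g2|]; first exact: tmulDr.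
by exists `|f| => // g; rewrite tmul_norm.
Qed.

Lemma tmulBl f1 f2 g : tmul (f1 - f2) g = tmul f1 g - tmul f2 g.
Proof. by apply: (addIr (tmul f2 g)); rewrite -tmulDl !subrK. Qed.

Lemma tmulBr f g1 g2 : tmul f (g1 - g2) = tmul f g1 - tmul f g2.
Proof. by apply: (addIr (tmul f g2)); rewrite -tmulDr !subrK. Qed.

Lemma tmulZr c f g : c *: tmul f g = tmul f (c *: g).
Proof.
move: f; apply: tga_eq; last 2 first.
- exact: tmul_boundedl.
- by move=> a; rewrite !tmul_tgl; have [_ -> _ _] := lmul_opP a.
have [aD [M M0 aM]] := tmul_boundedl g.
split=> [f1 f2|]; first by rewrite aD scalerDr.
exists (`|c| * M) => [|f]; first exact: mulr_ge0.
by rewrite normrZ -mulrA ler_wpM2l.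
Qed.

Lemma tmulA : associative tmul.
Proof.
move=> f g h; move: f; apply: tga_eq.
- exact: tmul_boundedl.
- exact: (bounded_additive_comp (tmul_boundedl h) (tmul_boundedl g)).
move=> a; move: g; apply: tga_eq.
- exact: (bounded_additive_comp (tmul_boundedr (tg a)) (tmul_boundedl h)).
- exact: (bounded_additive_comp (tmul_boundedl h) (tmul_boundedr (tg a))).
move=> b; move: h; apply: tga_eq.
- exact: (bounded_additive_comp (tmul_boundedr (tg a)) (tmul_boundedr (tg b))).
- exact: (tmul_boundedr _).
by move=> c; rewrite !tmul_tg; apply: tg_lin => k; rewrite lin_mulA.
Qed.

Definition tone : tga := tg (delta R 0).

Lemma id_bounded : bounded_additive (id : tga -> tga).
Proof. by split => //; exists 1 => // f; rewrite mul1r. Qed.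

Lemma tmul1 : left_id tone tmul.
Proof.
apply: tga_eq; [exact: tmul_boundedr|exact: id_bounded|] => a.
by rewrite tmul_tg; apply: tg_lin => h; rewrite lin_mul1l.
Qed.

Lemma tmulr1 : right_id tone tmul.
Proof.
apply: tga_eq; [exact: tmul_boundedl|exact: id_bounded|] => a.
by rewrite tmul_tg; apply: tg_lin => h; rewrite lin_mul1r.
Qed.

Lemma tone_neq0 : tone != 0.
Proof.
rewrite -normr_gt0 (lt_le_trans _ (nrm2_le _)) // nrm2_delta.
exact: ltr01.
Qed.

Fact star_ext : exists F : tga -> tga,
  [/\ forall f g, F (f + g) = F f + F g, forall c f, F (c *: f) = Num.conj c *: F f,
      forall f, `|F f| <= 1 * `|f| & forall a, F (tg a) = tg (lstar w a)].
Proof.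
apply: (@emb_ext _ _ _ _ mcoef_le1 tga Num.conj (fun a => tg (lstar w a)) 1) => //.
- by move=> c; rewrite norm_conjC.
- by move=> b c; apply: uspanP => t; rewrite uspanD /tg !embE lin_starD.
- by move=> k b; apply: uspanP => t; rewrite uspanZ /tg !embE lin_starZ.
- by move=> a; rewrite mul1r tg_norm_star.
Qed.

Definition tstar : tga -> tga := sval (cid star_ext).

Lemma tstarD : {morph tstar : f g / f + g}.
Proof. by have [D _ _ _] := svalP (cid star_ext); exact: D. Qed.

Lemma tstarB f g : tstar (f - g) = tstar f - tstar g.
Proof. by apply: (addIr (tstar g)); rewrite -tstarD !subrK. Qed.

Lemma tstarZ c f : tstar (c *: f) = Num.conj c *: tstar f.
Proof. by have [_ Z _ _] := svalP (cid star_ext); exact: Z. Qed.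

Lemma tstar_tg a : tstar (tg a) = tg (lstar w a).
Proof. by have [_ _ _ E] := svalP (cid star_ext); exact: E. Qed.

Lemma tstar_le f : `|tstar f| <= `|f|.
Proof.
by have [_ _ M _] := svalP (cid star_ext); rewrite (le_trans (M f)) ?mul1r.
Qed.

Lemma tstar_bounded : bounded_additive tstar.
Proof.
by split; [exact: tstarD|exists 1 => // f; rewrite mul1r tstar_le].
Qed.

Lemma tstarK : involutive tstar.
Proof.
apply: tga_eq; last 2 first.
- exact: id_bounded.
- by move=> a; rewrite !tstar_tg; apply: tg_lin => h; rewrite lin_starK.
exact: (bounded_additive_comp tstar_bounded tstar_bounded).
Qed.

Lemma tstarM f g : tstar (tmul f g) = tmul (tstar g) (tstar f).
Proof.
move: f; apply: tga_eq.
- exact: (bounded_additive_comp tstar_bounded (tmul_boundedl g)).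
- exact: (bounded_additive_comp (tmul_boundedr _) tstar_bounded).
move=> a; move: g; apply: tga_eq.
- exact: (bounded_additive_comp tstar_bounded (tmul_boundedr _)).
- exact: (bounded_additive_comp (tmul_boundedl _) tstar_bounded).
move=> b; rewrite !(tmul_tg, tstar_tg); apply: tg_lin => h.
by rewrite lin_starM.
Qed.

Lemma tstar_norm f : `|tstar f| = `|f|.
Proof. by apply/eqP; rewrite eq_le tstar_le -{1}[f]tstarK tstar_le. Qed.

Lemma tstar_mul_near f g (d : K) : d <= 1 -> `|f - g| <= d ->
  `|tmul (tstar f) f - tmul (tstar g) g| <= d * (2 * `|f| + 1).
Proof.
move=> d1 fg; have d0 : 0 <= d := le_trans (normr_ge0 _) fg.
have gf : `|g| <= `|f| + 1.
  have := ler_normB f (f - g); rewrite subKr => /le_trans; apply.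
  by rewrite lerD2l (le_trans fg).
have -> : tmul (tstar f) f - tmul (tstar g) g =
    tmul (tstar (f - g)) f + tmul (tstar g) (f - g).
  by rewrite tstarB tmulBl tmulBr addrA subrK.
have -> : d * (2 * `|f| + 1) = d * `|f| + d * (`|f| + 1) by ring.
rewrite (le_trans (ler_normD _ _)) // lerD //.
  by rewrite (le_trans (tmul_norm _ _)) // tstar_norm ler_wpM2r.
by rewrite (le_trans (tmul_norm _ _)) // tstar_norm mulrC ler_pM.
Qed.

Lemma tnormE f : `|tmul (tstar f) f| = `|f| ^+ 2.
Proof.
apply/eqP; rewrite eq_le; apply/andP; split.
  by rewrite (le_trans (tmul_norm _ _)) // tstar_norm expr2.
(* Replacing [|f| ^+ 2] by [|tg a| ^+ 2] costs [d * (2 * |f| + 3)], and replacing the products, by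
   [tstar_mul_near], costs [d * (2 * |f| + 1)]. *)
apply: (@ler_addM_arbitrarily_small K _ _ ((2 * `|f| + 3) + (2 * `|f| + 1))).
  by rewrite !addr_ge0 // mulr_ge0.
move=> d d0 d1; have [a fa] := emb_dense mcoef_le1 f d0; rewrite -/(tg a) in fa.
have af : `|tg a| <= `|f| + 1.
  have := ler_normB f (f - tg a); rewrite subKr => /le_trans; apply.
  by rewrite lerD2l (le_trans fa).
have fa' : `|f| <= `|tg a| + d.
  by rewrite -[f](subrK (tg a)) addrC (le_trans (ler_normD _ _)) // lerD2l.
apply: (@le_trans _ _ (`|tg a| ^+ 2 + d * (2 * `|f| + 3))).
  apply: (@le_trans _ _ ((`|tg a| + d) ^+ 2)).
    by rewrite ler_pXn2r ?nnegrE ?addr_ge0 // ltW.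
  rewrite sqrrD -addrA lerD2l expr2 -mulr_natl.
  have -> : 2 * (`|tg a| * d) + d * d = d * (2 * `|tg a| + d) by ring.
  have -> : 2 * `|f| + 3 = 2 * (`|f| + 1) + 1 by ring.
  by apply: ler_wpM2l; [exact: ltW|rewrite lerD // ler_wpM2l].
have -> : (2 * `|f| + 3 + (2 * `|f| + 1)) * d =
  d * (2 * `|f| + 1) + d * (2 * `|f| + 3) by ring.
rewrite [leRHS]addrA lerD2r (le_trans (tg_normE a)) // -tmul_tg -tstar_tg.
rewrite -lerBlDl (le_trans _ (tstar_mul_near d1 fa)) //.
by rewrite distrC lerB_dist.
Qed.

Definition tgroup_cstar : cstarAlgebra R :=
  @CStarAlgebra R tga tone tmul tstar tmulA tmul1 tmulr1 tmulDl tmulDr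
    tone_neq0 tmulZl tmulZr tstarK tstarD tstarZ tstarM tmul_norm tnormE.

End TwistedGroupAlgebra.

(** * Universality *)

(** A polynomial factor is lost in the limit of [2 ^ m]-th roots. The argument avoids roots: if
    [x / y] exceeded 1, its powers would outgrow every polynomial by Bernoulli's inequality. *)
Lemma le_of_exp_le_poly (F : archiRealFieldType) (x y : F) (s : nat) : 0 <= y ->
  (forall m, x ^+ (2 ^ m) <= (2 ^ m).+1%:R ^+ s * y ^+ (2 ^ m)) -> x <= y.
Proof.
move=> y0 xy; rewrite leNgt; apply/negP => yx.
have x0 : 0 < x := le_lt_trans y0 yx.
have {}y0 : 0 < y.
  rewrite lt0r y0 andbT; apply/eqP => yE.
  by have := xy 0; rewrite yE expn0 !expr1 mulr0 leNgt x0.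
pose q := x / y - 1.
have q0 : 0 < q by rewrite subr_gt0 ltr_pdivlMr ?mul1r.
have r1 : 1 <= x / y by rewrite -subr_ge0 ltW.
have bern n : n%:R * q <= (x / y) ^+ n.
  elim: n => [|n IH]; first by rewrite mul0r.
  rewrite exprS -natr1 mulrDl mul1r addrC.
  rewrite (_ : x / y * _ = q * (x / y) ^+ n + (x / y) ^+ n); last by rewrite /q; ring.
  by apply: lerD => //; apply: ler_peMr; [exact: ltW|exact: exprn_ege1].
(* Take [m = i + s]. As [s < 2 ^ s], the Bernoulli bound at [2 ^ i], raised to the power [s.+1],
   still lies below [(x / y) ^+ (2 ^ (i + s))]. Dividing by the [s]-th power of [2 ^ i] leaves one
   factor [2 ^ i], which would then be bounded. *)
have ub i : (2 ^ i)%:R * q ^+ s.+1 <= (2 ^ s.+1)%:R ^+ s.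
  have : ((2 ^ i)%:R * q) ^+ s.+1 <= (2 ^ (i + s)).+1%:R ^+ s.
    apply: (@le_trans _ _ ((x / y) ^+ (2 ^ (i + s)))); last first.
      by rewrite expr_div_n ler_pdivrMr ?exprn_gt0.
    rewrite expnD exprM; apply: (@le_trans _ _ ((x / y) ^+ (2 ^ i) ^+ s.+1)).
      apply: lerXn2r; [|exact: exprn_ge0 (le_trans ler01 r1)|exact: bern].
      by rewrite nnegrE mulr_ge0 // ltW.
    by apply: ler_weXn2l; [exact: exprn_ege1|exact: ltn_expl].
  have -> : (2 ^ i)%:R * q ^+ s.+1 =
      ((2 ^ i)%:R * q) ^+ s.+1 / (2 ^ i)%:R ^+ s :> F.
    rewrite exprMn [X in X * _ / _]exprS -!mulrA; congr (_ * _).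
    by rewrite mulrCA mulfV ?mulr1 // expf_neq0 // pnatr_eq0 expn_eq0.
  move=> /le_trans H; rewrite ler_pdivrMr ?exprn_gt0 ?ltr0n ?expn_gt0 //; apply: H.
  rewrite -exprMn lerXn2r ?nnegrE ?mulr_ge0 // -natrM ler_nat.
  by rewrite mulnC -expnD addnS expnS mul2n -addnn -addn1 leq_add2l expn_gt0.
have q1 : 0 < q ^+ s.+1 by rewrite exprn_gt0.
pose i := Num.bound ((2 ^ s.+1)%:R ^+ s / q ^+ s.+1).
have := upper_nthrootP (leqnn i).
by move: (ub i); rewrite natrX => ubi; rewrite ltr_pdivrMr // ltNge ubi.
Qed.

(** * Polynomial growth of the supports of powers *)

Section Growth.
Variables (R : realType) (X : zmodType) (w : bicharacter R X).
Notation K := R[i].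
Notation L := (seq (K * X)).

Definition lpow (b : L) (k : nat) : L := iter k (lmul w b) (delta R 0).

Lemma mem_lpow (b : L) k z : z \in unzip2 (lpow b k) ->
  exists n : {ffun 'I_(size b) -> 'I_k.+1},
    z = \sum_(i < size b) nth 0 (unzip2 b) i *+ n i.
Proof.
elim: k z => [|k IH] z.
  rewrite mem_seq1 => /eqP ->; exists [ffun=> ord0].
  by rewrite big1 // => i _; rewrite ffunE.
rewrite /= /unzip2 map_allpairs => /allpairsP[[p q] /= [pb qk ->]].
have [n ->] := IH q.2 (map_f snd qk).
have pi : (index p b < size b)%N by rewrite index_mem.
pose i0 := Ordinal pi.
(* The multiplicity of the new factor grows by one; it stays at most [k.+1], so [inord] does not
   fall back to its default. *)
exists [ffun i => inord (n i + (i == i0))].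
have nE i : ([ffun i => inord (n i + (i == i0))] i : 'I_k.+2) = (n i + (i == i0))%N :> nat.
  rewrite ffunE inordK // ltnS -[leqRHS]addn1.
  exact: leq_add (leq_ord (n i)) (leq_b1 _).
rewrite [RHS](eq_bigr (fun i : 'I_(size b) => nth 0 (unzip2 b) i *+ n i + nth 0 (unzip2 b) i *+ (i == i0)));
  last by move=> i _; rewrite nE mulrnDr.
rewrite big_split /= addrC; congr (_ + _).
rewrite (bigD1 i0) //= eqxx big1 ?addr0 => [|i /negbTE ->//].
by rewrite (nth_map 0) ?nth_index.
Qed.

(** As [X] is abelian, a product of [k] terms of [b] lies at a point determined by the
    multiplicities of the terms, each between 0 and [k]. *)
Lemma size_supp_lpow (b : L) k : (size (supp (lpow b k)) <= k.+1 ^ size b)%N.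
Proof.
pose f (n : {ffun 'I_(size b) -> 'I_k.+1}) : X :=
  \sum_(i < size b) nth 0 (unzip2 b) i *+ n i.
have : {subset supp (lpow b k) <= codom f}.
  by move=> z; rewrite mem_undup => /mem_lpow[n ->]; exact: codom_f.
move/(uniq_leq_size (undup_uniq _)); rewrite size_codom card_ffun !card_ord.
exact.
Qed.

Lemma tg_lpow_le (b : L) k : `|tg w (lpow b k)| <= `|tg w b| ^+ k.
Proof.
elim: k => [|k IH].
  rewrite expr0; apply: tg_norm_le => // c d.
  by rewrite mul1r ip_lmul_delta_le.
by rewrite /= exprS (le_trans (tg_normM _ _ _)) // ler_wpM2l.
Qed.

(** Cauchy-Schwarz for the indicator function of the support and the moduli of the coefficients. *)
Lemma sum_coef_le (a : L) :
  (\sum_(x <- supp a) `|coef a x|) ^+ 2 <= (size (supp a))%:R * ip a a.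
Proof.
pose e : L := [seq (1, x) | x <- supp a].
pose b : L := [seq (`|coef a x|, x) | x <- supp a].
have coef_seq (F : X -> K) x : x \in supp a ->
    coef [seq (F x, x) | x <- supp a] x = F x.
  move=> xa; rewrite /coef big_map (bigD1_seq x) ?undup_uniq //= eqxx mulr1.
  by rewrite big1 ?addr0 // => y /negbTE ->; rewrite mulr0.
have eb : ip e b = \sum_(x <- supp a) `|coef a x|.
  rewrite /ip big_map big_seq [RHS]big_seq; apply: eq_bigr => x xa /=.
  by rewrite conjC1 mul1r coef_seq.
have ee : ip e e = (size (supp a))%:R.
  rewrite /ip big_map big_seq (eq_bigr (fun=> 1)) => [|x xa].
    by rewrite -big_seq big_const_seq count_predT iter_addr_0.
  by rewrite /= conjC1 mul1r coef_seq.
have bb : ip b b = ip a a.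
  rewrite (ip_diag a) /ip big_map big_seq [RHS]big_seq; apply: eq_bigr => x xa /=.
  by rewrite coef_seq // geC0_conj // expr2.
rewrite -ee -bb -eb (le_trans _ (ip_cauchy_schwarz e b)) //.
by rewrite ger0_norm // eb sumr_ge0.
Qed.

End Growth.

Section CstarTheory.
Variables (R : realType) (A : cstarAlgebra R).
Notation K := R[i].
Implicit Types a b : A.

Lemma starK a : star (star a) = a. Proof. exact: cstar_starK. Qed.

Lemma starD a b : star (a + b) = star a + star b. Proof. exact: cstar_starD. Qed.

Lemma starZ (c : K) a : star (c *: a) = Num.conj c *: star a.
Proof. exact: cstar_starZ. Qed.

Lemma starM a b : star (a * b) = star b * star a. Proof. exact: cstar_starM. Qed.

Lemma star0 : star (0 : A) = 0.
Proof. by have := starZ 0 (0 : A); rewrite conjC0 !scale0r. Qed.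

Lemma star1 : star (1 : A) = 1.
Proof. by have := starM (star 1) (1 : A); rewrite mulr1 starK mulr1. Qed.

Lemma cstar_normM a b : `|a * b| <= `|a| * `|b|.
Proof. exact: cstar_ler_normM. Qed.

Lemma normr_star a : `|star a * a| = `|a| ^+ 2.
Proof. exact: cstar_normE. Qed.

Lemma cstar_norm1 : `|1 : A| = 1.
Proof.
have n0 : `|1 : A| != 0 by rewrite normr_eq0 oner_neq0.
by apply: (mulIf n0); rewrite mul1r -expr2 -normr_star star1 mulr1.
Qed.

Lemma cstar_norm_star a : `|star a| = `|a|.
Proof.
have le b : `|b| <= `|star b|.
  have [->|b0] := eqVneq b 0; first by rewrite star0.
  have bp : 0 < `|b| by rewrite normr_gt0.
  by rewrite -(ler_pM2r bp) -expr2 -normr_star cstar_normM.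
by apply/eqP; rewrite eq_le le andbT -{2}[a]starK le.
Qed.

Lemma unitary_norm a : unitary a -> `|a| = 1.
Proof.
case=> aa _; apply/eqP; rewrite -(@sqrp_eq1 K) ?normr_ge0 //.
by rewrite -normr_star aa cstar_norm1.
Qed.

(** For self-adjoint elements the C*-identity says that squaring squares the norm, whence exponents
    that are powers of two. *)
Lemma norm_selfadjoint_exp a m : star a = a -> `|a ^+ (2 ^ m)| = `|a| ^+ (2 ^ m).
Proof.
move=> aa; have sX k : star (a ^+ k) = a ^+ k.
  elim: k => [|k IH]; first by rewrite expr0 star1.
  by rewrite [in LHS]exprS starM IH aa -exprSr.
elim: m => [|m IH]; first by rewrite expn0 !expr1.
by rewrite expnSr !exprM -IH -normr_star sX -expr2.
Qed.

End CstarTheory.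

Section UniversalProperty.
Variables (R : realType) (X : zmodType) (w : bicharacter R X).
Variables (B : cstarAlgebra R) (h : X -> B).
Hypothesis hU : forall x, unitary (h x).
Hypothesis hM : forall x y, h x * h y = w x y *: h (x + y).
Notation K := R[i].
Notation L := (seq (K * X)).
Implicit Types a b : L.

Lemma proj_rep0 : h 0 = 1.
Proof.
have [h0 _] := hU 0; have := hM 0 0; rewrite addr0 bichar0l scale1r.
by move=> /(congr1 (fun u => star (h 0) * u)); rewrite mulrA h0 mul1r.
Qed.

Lemma proj_rep_star x : star (h x) = w x x *: h (- x).
Proof.
have [hx _] := hU x; have := hM x (- x).
rewrite subrr proj_rep0 => /(congr1 (fun u => star (h x) * u)).
rewrite mulrA hx mul1r bicharNr -scalerAr mulr1 => ->.
by rewrite scalerA bicharK scale1r.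
Qed.

Lemma lin_rep_mul a b : lin h (lmul w a b) = lin h a * lin h b.
Proof.
rewrite lin_mulE [in RHS]/lin mulr_suml; apply: eq_bigr => p _.
rewrite mulr_sumr; apply: eq_bigr => q _.
by rewrite -[RHS]scalerAl -[X in _ = _ *: X]scalerAr hM !scalerA.
Qed.

Lemma lin_rep_star a : lin h (lstar w a) = star (lin h a).
Proof.
rewrite lin_starE /lin (big_morph _ (@starD R B) (@star0 R B)).
by apply: eq_bigr => p _; rewrite starZ proj_rep_star scalerA.
Qed.

Lemma lin_rep_one : lin h (delta R 0) = 1.
Proof. by rewrite lin_delta proj_rep0. Qed.

Lemma lin_rep_pow b k : lin h (lpow w b k) = lin h b ^+ k.
Proof.
elim: k => [|k IH]; first by rewrite expr0 lin_rep_one.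
by rewrite /= lin_rep_mul IH exprS.
Qed.

(** The crude estimate: unitaries have norm 1, so the image is bounded by the sum of the moduli of
    the coefficients, hence by the square-sum norm times the root of the support size. *)
Lemma lin_rep_le a : `|lin h a| ^+ 2 <= (size (supp a))%:R * `|tg w a| ^+ 2.
Proof.
apply: (@le_trans _ _ ((\sum_(x <- supp a) `|coef a x|) ^+ 2)).
  rewrite lerXn2r ?nnegrE ?normr_ge0 ?sumr_ge0 // lin_supp.
  rewrite (le_trans (ler_norm_sum _ _ _)) // ler_sum // => x _.
  by rewrite normrZ unitary_norm ?mulr1.
rewrite (le_trans (sum_coef_le a)) // ler_wpM2l // -nrm2K.
by rewrite lerXn2r ?nnegrE ?nrm2_ge0 ?normr_ge0 ?nrm2_le.
Qed.

(** The crude estimate is applied to the powers [2 ^ m] of [b], standing for [star a * a]. In [B]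
    the norms of these powers are exact, in the regular norm they are submultiplicative, and the
    support size is polynomial in [2 ^ m], so it disappears by [le_of_exp_le_poly]. *)
Lemma lin_rep_contractive a : `|lin h a| <= `|tg w a|.
Proof.
pose b := lmul w (lstar w a) a.
have bE : lin h b = star (lin h a) * lin h a by rewrite lin_rep_mul lin_rep_star.
have bs : star (lin h b) = lin h b by rewrite bE starM starK.
have nb : `|tg w b| <= `|tg w a| ^+ 2.
  by rewrite (le_trans (tg_normM _ _ _)) // expr2 ler_wpM2r ?tg_norm_star.
(* The exponent 4 combines the square in [lin_rep_le] with the square in the C*-identity. *)
have key m : (`|lin h a| ^+ 4) ^+ (2 ^ m) <=
    (2 ^ m).+1%:R ^+ size b * (`|tg w a| ^+ 4) ^+ (2 ^ m).
  have -> : (`|lin h a| ^+ 4) ^+ (2 ^ m) = `|lin h (lpow w b (2 ^ m))| ^+ 2.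
    rewrite lin_rep_pow norm_selfadjoint_exp // bE normr_star -!exprM.
    by rewrite mulnCA mulnC.
  rewrite (le_trans (lin_rep_le _)) // ler_pM ?exprn_ge0 //.
    by rewrite -natrX ler_nat size_supp_lpow.
  rewrite (le_trans (lerXn2r 2 _ _ (tg_lpow_le w b (2 ^ m)))) ?nnegrE ?exprn_ge0 //.
  have -> : (`|tg w a| ^+ 4) ^+ (2 ^ m) = ((`|tg w a| ^+ 2) ^+ (2 ^ m)) ^+ 2.
    by rewrite -!exprM; congr (_ ^+ _); rewrite mulnCA mulnC.
  by rewrite !lerXn2r ?nnegrE ?exprn_ge0 ?normr_ge0.
(* The norms are nonnegative elements of [R[i]]; taking real parts moves the inequality to the
   archimedean field [R]. *)
have real_norm (u : K) : 0 <= u -> (complex.Re u)%:C = u.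
  by move=> u0; rewrite RRe_real // ger0_real.
rewrite -(@ler_pXn2r _ 4) ?nnegrE ?normr_ge0 //.
have xE := real_norm _ (exprn_ge0 4 (normr_ge0 (lin h a))).
have yE := real_norm _ (exprn_ge0 4 (normr_ge0 (tg w a))).
move: (complex.Re _) (complex.Re _) xE yE => y x xE yE.
rewrite -xE -yE lecR; apply: (@le_of_exp_le_poly _ _ _ (size b)) => [|m].
  by rewrite -ler0c yE exprn_ge0.
have toC : ((2 ^ m).+1%:R ^+ size b * y ^+ (2 ^ m))%:C =
    (2 ^ m).+1%:R ^+ size b * y%:C ^+ (2 ^ m).
  by rewrite rmorphM !rmorphXn /= rmorph_nat.
rewrite -lecR toC rmorphXn /= xE yE; exact: key.
Qed.


End UniversalProperty.

(** * Simplicity *)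

Lemma closed_approx (K : numFieldType) (V : normedModType K) (S : set V) (x : V) :
  closed S -> (forall e, 0 < e -> exists2 y, S y & `|x - y| <= e) -> S x.
Proof.
move=> Sc xS; apply: Sc => U /nbhs_ballP[e /= e0 eU].
have [y Sy xy] := xS (e / 2) (divr_gt0 e0 (ltr0n _ 2)).
exists y; split => //; apply: eU; rewrite -ball_normE /=.
by rewrite (le_lt_trans xy) // ltr_pdivrMr // ltr_pMr // ltr1n.
Qed.

Section TgroupTheory.
Variables (R : realType) (X : zmodType) (w : bicharacter R X).
Notation K := R[i].
Notation L := (seq (K * X)).
Notation A := (tgroup_cstar w).

(* The canonical unitaries l_Theta(x) of the paper, up to a scalar phase. *)
Definition tgu (x : X) : A := tg w (delta R x).

Lemma tguM x y : tgu x * tgu y = w x y *: tgu (x + y).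
Proof.
transitivity (tg w (lmul w (delta R x) (delta R y)) : A); first exact: tmul_tg.
rewrite /tgu; apply: uspanP => t.
by rewrite uspanZ /tg !embE lin_mul_delta lin_delta.
Qed.

Lemma tgu0 : tgu 0 = 1. Proof. by []. Qed.

Lemma tgu_unitary x : unitary (tgu x).
Proof.
rewrite /unitary; have -> : star (tgu x) = tg w (lstar w (delta R x)) :> A by exact: tstar_tg.
split.
  transitivity (tg w (lmul w (lstar w (delta R x)) (delta R x)) : A);
    first exact: tmul_tg.
  by apply: tg_lin => h; rewrite lin_star_delta lin_delta.
transitivity (tg w (lmul w (delta R x) (lstar w (delta R x))) : A);
  first exact: tmul_tg.
by apply: tg_lin => h; rewrite lin_delta_star lin_delta.
Qed.

Lemma tg_cons p a : tg w (p :: a) = p.1 *: tgu p.2 + (tg w a : A).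
Proof. exact: emb_cons. Qed.

Lemma tgu_generates (S : set A) :
  cstar_subalgebra S -> (forall x, S (tgu x)) -> S = setT.
Proof.
move=> [Sc [_ SD SZ _ _]] Sx; rewrite -subTset => f _.
have Stg a : S (tg w a).
  elim: a => [|p a IH]; last by rewrite tg_cons; apply: SD => //; exact: SZ.
  have -> : tg w [::] = 0 *: tgu 0 :> A.
    by rewrite scale0r; exact: emb_nil.
  exact: SZ.
apply: closed_approx Sc _ => e e0; have [a fa] := emb_dense (mcoef_le1 w) f e0.
by exists (tg w a).
Qed.

(** Contractivity on finite sums is exactly the bound under which [lin h] extends; multiplicativity
    and compatibility with the star pass to the closure by density. *)
Lemma tgroup_universal (B : cstarAlgebra R) (h : X -> B) :
  (forall x, unitary (h x)) -> (forall x y, h x * h y = w x y *: h (x + y)) ->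
  exists F : {lrmorphism A -> B},
    (forall a, F (star a) = star (F a)) /\ forall x, F (tgu x) = h x.
Proof.
move=> hU hM.
have [F [FD FZ FM FE]] := @emb_ext _ _ _ _ (mcoef_le1 w) B idfun (lin h) 1
  (fun=> erefl) ler01 (lin_cat h) (lin_scale h)
  (fun a => eq_ind_r (fun u => `|lin h a| <= u)
     (lin_rep_contractive hU hM a) (mul1r `|tg w a|)).
have FB : bounded_additive F by split => //; exists 1.
have Fmul (f g : A) : F (f * g) = F f * F g.
  move: f; apply: (@tga_eq _ _ w B).
  - exact: (bounded_additive_comp FB (tmul_boundedl g)).
  - split=> [f1 f2|]; first by rewrite FD mulrDl.
    exists `|F g| => // f; rewrite mulrC (le_trans (cstar_normM _ _)) //.
    by rewrite ler_wpM2r // (le_trans (FM f)) // mul1r.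
  move=> a; move: g; apply: (@tga_eq _ _ w B).
  - exact: (bounded_additive_comp FB (tmul_boundedr _)).
  - split=> [f1 f2|]; first by rewrite FD mulrDr.
    exists `|F (tg w a)| => // f; rewrite (le_trans (cstar_normM _ _)) //.
    by rewrite ler_wpM2l // (le_trans (FM f)) // mul1r.
  move=> b; transitivity (F (tg w (lmul w a b))); first by congr F; exact: tmul_tg.
  by rewrite !FE (lin_rep_mul hM).
have Fstar (f : A) : F (star f) = star (F f).
  move: f; apply: (@tga_eq _ _ w B).
  - exact: (bounded_additive_comp FB (tstar_bounded w)).
  - split=> [f1 f2|]; first by rewrite FD starD.
    by exists 1 => // f; rewrite cstar_norm_star.
  move=> a; transitivity (F (tg w (lstar w a))); first by congr F; exact: tstar_tg.
  by rewrite !FE (lin_rep_star hU hM).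
pose linF := GRing.isLinear.Build K A B *:%R F (fun c u v => etrans (FD _ _) (congr1 (+%R^~ _) (FZ _ _))).
pose multF := GRing.isMonoidMorphism.Build A B F (conj (etrans (FE (delta R 0)) (lin_rep_one hU hM)) Fmul).
pose Fm : {lrmorphism A -> B} := HB.pack F linF multF.
exists Fm; split => // x.
by rewrite -[RHS](lin_delta h x) -FE.
Qed.

Lemma nrm2_lmul_deltar a y : nrm2 (lmul w a (delta R y)) = nrm2 a.
Proof.
have coefE z : coef (lmul w a (delta R y)) z =
    \sum_(q <- a) q.1 * w q.2 y * (q.2 + y == z)%:R.
  rewrite /coef /lmul big_allpairs_dep; apply: eq_bigr => q _.
  by rewrite big_seq1 /= mulr1.
rewrite /nrm2; congr sqrtC; rewrite {1}/ip {1}/lmul big_allpairs_dep.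
apply: eq_bigr => p _; rewrite big_seq1 /= mulr1 coefE /coef.
rewrite !mulr_sumr; apply: eq_bigr => q _; rewrite rmorphM /=.
rewrite (inj_eq (addIr y)); case: eqP => [->|_]; last by rewrite !mulr0.
rewrite !mulr1; transitivity (Num.conj p.1 * q.1 * (w p.2 y * Num.conj (w p.2 y))); first by ring.
by rewrite bicharK; ring.
Qed.

(** Right multiplication by a [delta] is isometric, so [a] applied to the fixed vector [t.1] has
    norm at most [nrm2 a] times the sum of the moduli of the coefficients of [t.1]. Hence the vector
    at 0 is separating. *)
Lemma tg_matrix_le t : exists2 C : K, 0 <= C &
  forall a, `|tg w a t| <= C * nrm2 a.
Proof.
pose S := \sum_(q <- t.1) `|q.1|.
have S0 : 0 <= S by apply: sumr_ge0.
have n0 : 0 <= (nrm2 t.1 * nrm2 t.2)^-1 by rewrite invr_ge0 mulr_ge0 ?nrm2_ge0.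
exists (S * nrm2 t.2 * (nrm2 t.1 * nrm2 t.2)^-1) => [|a].
  by rewrite !mulr_ge0 ?nrm2_ge0.
rewrite tgE normrM [X in _ * X]ger0_norm // mulrAC ler_wpM2r //.
have -> : ip t.2 (lmul w a t.1) =
    \sum_(q <- t.1) q.1 * ip t.2 (lmul w a (delta R q.2)).
  rewrite ip_lin; elim: t.1 => [|q b IH].
    by rewrite big_nil lin_mulE big1 // => p _; rewrite big_nil.
  rewrite big_cons -IH -[q :: b]/([:: q] ++ b) lin_mulDr; congr (_ + _).
  rewrite [X in _ * X]ip_lin -[RHS]lin_mulZr /lscale /=.
  by rewrite mulr1 -surjective_pairing.
rewrite (le_trans (ler_norm_sum _ _ _)) // /S !mulr_suml ler_sum // => q _.
rewrite normrM -mulrA ler_wpM2l // (le_trans (ip_le _ _)) //.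
by rewrite nrm2_lmul_deltar.
Qed.

(* The canonical trace, read off as a matrix coefficient. *)
Definition trace (f : A) : K := (f : tga w) (delta R 0, delta R 0).

Lemma trace_tg a : trace (tg w a) = coef a 0.
Proof.
rewrite /trace tgE /= nrm2_delta mulr1 invr1 mulr1 ip_lin lin_mul1r -ip_lin.
exact: ip_delta.
Qed.

Lemma trace_le (f g : A) : `|trace f - trace g| <= `|f - g|.
Proof. by rewrite /trace -uspanB; exact: ler_uspan_norm. Qed.

Lemma trace_lstar a : trace (star (tg w a : A) * (tg w a : A)) = ip a a.
Proof.
have -> : star (tg w a : A) * (tg w a : A) = tg w (lmul w (lstar w a) a).
  by transitivity (tmul (tg w (lstar w a)) (tg w a) : A);
     [congr (_ * _); exact: tstar_tg | exact: tmul_tg].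
rewrite trace_tg -ip_delta -ip_adj.
by rewrite ip_conj ip_lin lin_mul1r -ip_lin -ip_conj.
Qed.

(** On finite sums [trace (star a * a)] is [nrm2 a ^+ 2], so sums approximating [f] have small
    [nrm2], and [tg_matrix_le] makes every matrix coefficient of [f] vanish. *)
Lemma trace_faithful (f : A) : trace (star f * f) = 0 -> f = 0.
Proof.
move=> f0; apply: uspanP => t; rewrite uspan0.
have [C C0 aC] := tg_matrix_le t.
pose D : K := sqrtC (2 * `|f : tga w| + 1).
have D0 : 0 <= 2 * `|f : tga w| + 1 by rewrite addr_ge0 // mulr_ge0.
apply: (@norm_arbitrarily_small _ _ _ (1 + C * D)).
  by rewrite addr_ge0 // mulr_ge0 // sqrtC_ge0.
(* Accuracy [d ^+ 2] is needed because [nrm2 a] is the square root of a trace error. *)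
move=> d d0 d1; have d20 : 0 < d ^+ 2 by rewrite exprn_gt0.
have d2d : d ^+ 2 <= d by rewrite expr2 ler_piMr // ltW.
have [a fa] := emb_dense (mcoef_le1 w) f d20.
have na : nrm2 a <= d * D.
  rewrite -(@ler_pXn2r _ 2) ?nnegrE ?nrm2_ge0 ?mulr_ge0 ?sqrtC_ge0 ?(ltW d0) //.
  rewrite exprMn nrm2K sqrtCK -trace_lstar -[trace _]subr0 -f0.
  rewrite -[leLHS]ger0_norm; last by rewrite f0 subr0 trace_lstar ip_ge0.
  rewrite distrC (le_trans (trace_le _ _)) //.
  exact: (tstar_mul_near (le_trans d2d d1) fa).
rewrite -[(f : tga w) t](subrK ((tg w a) t)) (le_trans (ler_normD _ _)) // mulrDl mul1r.
apply: lerD.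
  rewrite -uspanB (le_trans (ler_uspan_norm _ _)) //.
  exact: le_trans d2d.
by rewrite (le_trans (aC _)) // -mulrA ler_wpM2l // mulrC.
Qed.

Definition avg (y : X) (f : A) : A :=
  2^-1 *: (f + tgu y * f * star (tgu y)).

Definition avgs (s : seq X) (f : A) : A := foldr avg f s.

Lemma avgsD s f g : avgs s (f + g) = avgs s f + avgs s g.
Proof.
elim: s => //= y s ->; rewrite /avg -scalerDr mulrDr mulrDl.
by congr (_ *: _); rewrite addrACA.
Qed.

Lemma avgsZ s (c : K) f : avgs s (c *: f) = c *: avgs s f.
Proof.
elim: s => //= y s ->; rewrite /avg [RHS]scalerA [c * _]mulrC -scalerA.
by congr (_ *: _); rewrite scalerDr scalerAl scalerAr.
Qed.

Lemma avgsB s f g : avgs s (f - g) = avgs s f - avgs s g.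
Proof. by rewrite -scaleN1r avgsD avgsZ scaleN1r. Qed.

Lemma avgs1 s : avgs s 1 = 1.
Proof.
elim: s => //= y s ->; rewrite /avg mulr1; have [_ ->] := tgu_unitary y.
by rewrite -[1 + 1]mulr2n -(scaler_nat 2 (1 : A)) scalerA mulVf ?scale1r ?pnatr_eq0.
Qed.

Lemma avgs_norm s f : `|avgs s f| <= `|f|.
Proof.
elim: s => //= y s; apply: le_trans; set g := avgs s f.
have ny : `|tgu y| = 1 := unitary_norm (tgu_unitary y).
rewrite /avg normrZ ger0_norm ?invr_ge0 // ler_pdivrMl // mulr_natl mulr2n.
rewrite (le_trans (ler_normD _ _)) // lerD2l.
rewrite (le_trans (cstar_normM _ _)) // cstar_norm_star ny mulr1.
by rewrite (le_trans (cstar_normM _ _)) // ny mul1r.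
Qed.

Lemma avgs_ideal s f (I : set A) : closed_ideal I -> I f -> I (avgs s f).
Proof.
move=> [_ _ ID IM] If; elim: s => //= y s; set g := avgs s f => Ig.
rewrite /avg -[_ + _]mul1r scalerAl.
apply: (IM _ _ _).1; apply: ID => //.
by apply: (IM _ _ _).2; apply: (IM _ _ _).1.
Qed.

Definition avg_mult y x : K := 2^-1 * (1 + w y x * Num.conj (w x y)).

Lemma avg_tgu y x : avg y (tgu x) = avg_mult y x *: tgu x.
Proof.
rewrite /avg /avg_mult -scalerA; congr (_ *: _).
rewrite scalerDl scale1r; congr (_ + _).
have [_ yy] := tgu_unitary y.
have -> : tgu y * tgu x = (w y x * Num.conj (w x y)) *: (tgu x * tgu y).
  rewrite !tguM scalerA -mulrA [_ * w x y]mulrC bicharK mulr1.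
  by rewrite addrC.
by rewrite -scalerAl -mulrA yy mulr1.
Qed.

(** [avg_mult y x] is the midpoint of 1 and the unimodular commutator phase; by strict convexity of
    the disc it has modulus 1 only if that phase is 1. *)
Lemma avg_mult_norm y x : w x y != w y x -> `|avg_mult y x| < 1.
Proof.
move=> xy; set c := w y x * Num.conj (w x y).
have c1 : `|c| = 1 by rewrite normrM norm_conjC !bichar_norm mulr1.
rewrite normrM ger0_norm ?invr_ge0 // ltr_pdivrMl // mulr1.
have le2 : `|1 + c| <= 2 by rewrite (le_trans (ler_normD _ _)) // normr1 c1.
rewrite lt_neqAle le2 andbT; apply/eqP => e2.
have [|u u1 [e1 ec]] := @normCDeq K 1 c; first by rewrite e2 normr1 c1.
have cE : c = 1 by rewrite ec c1 [RHS]e1 normr1.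
case/eqP: xy; rewrite -[LHS]mulr1 -[RHS]mulr1 -{1}cE /c.
by rewrite -(bicharK w x y) mulrCA mulrA.
Qed.

Lemma exp_small (m e : K) : `|m| < 1 -> 0 < e -> exists N, `|m| ^+ N <= e.
Proof.
have RE (u : K) : 0 <= u -> u = (complex.Re u)%:C.
  by move=> u0; rewrite RRe_real // ger0_real.
move=> m1 e0; move: (RE _ (normr_ge0 m)) (RE _ (ltW e0)).
move: (complex.Re e) (complex.Re `|m|) => d r mE eE.
have r1 : `|r| < 1.
  by rewrite ger0_norm -?ltcR -?mE // -ler0c -mE.
have d0 : 0 < d by rewrite -ltcR -eE.
have /cvgrPdist_le/(_ _ d0)[N _ /(_ N (leqnn N))] := cvg_expr r1.
rewrite /= sub0r normrN => rN; exists N.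
rewrite mE eE -rmorphXn lecR (le_trans _ rN) //.
exact: ler_norm.
Qed.

Hypothesis nondeg : forall x, x != 0 -> exists y, w x y != w y x.

(** Induction on the terms. A term at 0 is fixed by all averages; a term at any other point is an
    eigenvector of every average, and [nondeg] gives a [y] whose eigenvalue has modulus below 1. *)
Lemma avgs_tg a (e : K) : 0 < e ->
  exists s, `|avgs s (tg w a) - coef a 0 *: 1| <= e.
Proof.
elim: a e => [|p a IH] e e0.
  exists [::]; rewrite /= /coef big_nil scale0r subr0.
  suff -> : tg w [::] = 0 :> A by rewrite normr0 ltW.
  exact: emb_nil.
have e20 : 0 < e / 2 by rewrite divr_gt0.
have [s sa] := IH _ e20.
have coefE : coef (p :: a) 0 = p.1 * (p.2 == 0)%:R + coef a 0 by rewrite /coef big_cons.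
have [p0|p0] := eqVneq p.2 0.
  exists s; rewrite tg_cons avgsD avgsZ coefE p0 eqxx mulr1 scalerDl tgu0 avgs1.
  by rewrite opprD addrACA subrr add0r (le_trans sa) // ler_pdivrMr // ler_peMr ?ltW // ltr1n.
have [y py] := nondeg p0; have m1 := avg_mult_norm py.
have [m sp] : exists m, avgs s (tgu p.2) = m *: tgu p.2.
  elim: s {sa} => [|z s [m sp]] /=; first by exists 1; rewrite scale1r.
  exists (m * avg_mult z p.2); rewrite sp -[avg z _]/(avgs [:: z] _) avgsZ.
  by rewrite /= avg_tgu scalerA.
have c0 : 0 < `|p.1 * m| + 1 by rewrite ltr_wpDl.
have [N Ne] := exp_small m1 (divr_gt0 e20 c0).
have NE n : avgs (nseq n y) (tgu p.2) = avg_mult y p.2 ^+ n *: tgu p.2.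
  elim: n => [|n IHn]; first by rewrite expr0 scale1r.
  rewrite /= IHn -[avg y _]/(avgs [:: y] _) avgsZ.
  by rewrite /= avg_tgu scalerA exprSr.
(* [avgs] folds from the right, so [s] acts first and settles the tail. The [N] further averages
   shrink the head geometrically and, being contractions fixing 1, preserve the estimate for the
   tail. *)
exists (nseq N y ++ s).
have catE f : avgs (nseq N y ++ s) f = avgs (nseq N y) (avgs s f) by rewrite /avgs foldr_cat.
rewrite catE tg_cons !avgsD !avgsZ sp avgsZ NE coefE (negbTE p0) mulr0 add0r.
rewrite -addrA (le_trans (ler_normD _ _)) // [leRHS]splitr lerD //.
  rewrite !scalerA normrZ normrM normrX unitary_norm ?mulr1; last exact: tgu_unitary.
  rewrite (le_trans (ler_wpM2l _ Ne)) // mulrA ler_pdivrMr // mulrC.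
  by apply: ler_wpM2l; [exact: ltW | rewrite lerDl].
have := avgs_norm (nseq N y) (avgs s (tg w a) - coef a 0 *: 1).
by rewrite avgsB avgsZ avgs1 => /le_trans; exact.
Qed.

Lemma tgroup_simple : simple_cstar A.
Proof.
move=> I II; have [_ I0 _ IM] := II; have [Ic _ ID _] := II.
have [[f If f0]|noI] := pselect (exists2 f, I f & f != 0); last first.
  left; apply/seteqP; split => [f If|_ ->//]; apply: contrapT => /eqP f0.
  by apply: noI; exists f.
right; pose g := star f * f.
have Ig : I g by apply: (IM _ _ _).1.
have tg0 : trace g != 0 by apply: contra f0 => /eqP/trace_faithful ->.
have It : I (trace g *: 1).
  apply: closed_approx Ic _ => e e0.
  have e40 : 0 < e / 2 / 2 by rewrite !divr_gt0.
  have [a ga] := emb_dense (mcoef_le1 w) g e40.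
  have [s sa] := avgs_tg a (divr_gt0 e0 (ltr0n _ 2)).
  exists (avgs s g); first exact: avgs_ideal.
  have -> : trace g *: 1 - avgs s g = (trace g - coef a 0) *: 1 -
      ((avgs s (tg w a) - coef a 0 *: 1) + avgs s (g - tg w a)).
    rewrite scalerBl avgsB [X in _ = _ - X]addrC addrA subrK opprB.
    by rewrite [RHS]addrA subrK.
  (* Three errors: the trace of [g] against that of [tg w a], the averaging of [tg w a], and the
     averages of [g - tg w a]. *)
  have -> : e = e / 2 / 2 + (e / 2 + e / 2 / 2) by rewrite addrCA -!splitr.
  rewrite (le_trans (ler_normB _ _)) // lerD //.
    rewrite normrZ cstar_norm1 mulr1 -trace_tg.
    exact: le_trans (trace_le _ _) ga.
  rewrite (le_trans (ler_normD _ _)) // lerD //.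
  exact: le_trans (avgs_norm _ _) ga.
rewrite -subTset => h _; rewrite -[h]mulr1.
apply: (IM _ _ _).1.
have -> : (1 : A) = ((trace g)^-1 *: 1) * (trace g *: 1).
  by rewrite -scalerAl mul1r scalerA mulVf // scale1r.
exact: (IM _ _ _).1.
Qed.

End TgroupTheory.

(** * Noncommutative tori *)

Section Expi.
Variable R : realType.
Implicit Types s t : R.

Lemma expi0 : expi (0 : R) = 1.
Proof. by rewrite /expi cos0 sin0. Qed.

Lemma expiD s t : expi (s + t) = expi s * expi t.
Proof. by rewrite /expi cosD sinD; simpc; congr (_ +i* _); ring. Qed.

Lemma norm_expi t : `|expi t| = 1.
Proof. by rewrite normc_def /= cos2Dsin2 sqrtr1. Qed.

Lemma expi_neq0 t : expi t != 0.
Proof. by rewrite -normr_gt0 norm_expi. Qed.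

Lemma expiN t : expi (- t) = (expi t)^-1.
Proof. by apply: (mulfI (expi_neq0 t)); rewrite -expiD subrr expi0 mulfV ?expi_neq0. Qed.

End Expi.

Section UnitaryPowers.
Variables (R : realType) (B : cstarAlgebra R).
Implicit Types (a b u v : B).

Lemma unitary1 : unitary (1 : B).
Proof. by rewrite /unitary star1 mulr1. Qed.

Lemma unitaryM a b : unitary a -> unitary b -> unitary (a * b).
Proof.
move=> [a1 a2] [b1 b2]; rewrite /unitary starM !mulrA; split.
  by rewrite -[_ * _ * a]mulrA a1 mulr1.
by rewrite -[a * _ * _]mulrA b2 mulr1.
Qed.

Lemma unitaryX a n : unitary a -> unitary (a ^+ n).
Proof.
move=> ua; elim: n => [|n IH]; first by rewrite expr0; exact: unitary1.
by rewrite exprS; exact: unitaryM.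
Qed.

Lemma unitary_star a : unitary a -> unitary (star a).
Proof. by move=> [a1 a2]; rewrite /unitary starK. Qed.

Definition upow a (z : int) : B :=
  match z with Posz n => a ^+ n | Negz n => star a ^+ n.+1 end.

Lemma unitary_upow a z : unitary a -> unitary (upow a z).
Proof.
by move=> ua; case: z => n /=; apply: unitaryX => //; exact: unitary_star.
Qed.

Lemma upowS a z : unitary a -> upow a (z + 1) = upow a z * a.
Proof.
move=> [a1 a2]; case: z => [n|[|n]].
- by rewrite -PoszD addn1 /= exprSr.
- by rewrite NegzE addNr /= expr0 expr1 a1.
rewrite (_ : Negz n.+1 + 1 = Negz n) /=; last by rewrite !NegzE -[n.+2]addn1 PoszD opprD subrK.
by rewrite [in RHS]exprSr -mulrA a1 mulr1.
Qed.

Lemma upowP a z : unitary a -> upow a (z - 1) = upow a z * star a.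
Proof.
move=> ua; have := upowS (z - 1) ua; rewrite subrK => ->.
by case: ua => _ a2; rewrite -mulrA a2 mulr1.
Qed.

Lemma upowD a m n : unitary a -> upow a (m + n) = upow a m * upow a n.
Proof.
move=> ua; elim/int_ind: n => [|n IH|n IH].
- by rewrite addr0 mulr1.
- by rewrite -addn1 PoszD addrA !upowS // IH mulrA.
- by rewrite -addn1 PoszD opprD addrA !upowP // IH mulrA.
Qed.

Lemma upow_comm u v t z : unitary u -> u * v = expi t *: (v * u) ->
  upow u z * v = expi (z%:~R * t) *: (v * upow u z).
Proof.
move=> uu uv; have [u1 u2] := uu.
have suv : star u * v = expi (- t) *: (v * star u).
  have : v * star u = expi t *: (star u * v).
    rewrite -[in LHS](mul1r v) -u1 -(mulrA (star u)) uv.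
    by rewrite -scalerAr -scalerAl -!mulrA u2 mulr1.
  by move=> ->; rewrite scalerA -expiD addNr expi0 scale1r.
elim/int_ind: z => [|n IH|n IH].
- by rewrite mul0r expi0 scale1r mul1r mulr1.
- rewrite -addn1 PoszD !upowS // -mulrA uv -scalerAr [X in _ *: X = _]mulrA IH -scalerAl.
  by rewrite scalerA -expiD -mulrA intrD mulrDl mul1r [t + _]addrC.
- rewrite -addn1 PoszD opprD !upowP // -mulrA suv -scalerAr [X in _ *: X = _]mulrA IH -scalerAl.
  by rewrite scalerA -expiD -mulrA intrB mulrBl mul1r [- t + _]addrC.
Qed.

Lemma comm_sym u v t : u * v = expi t *: (v * u) -> v * u = expi (- t) *: (u * v).
Proof. by move=> ->; rewrite scalerA -expiD addNr expi0 scale1r. Qed.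

Lemma upow_comm2 u v t m n : unitary u -> unitary v -> u * v = expi t *: (v * u) ->
  upow u m * upow v n = expi (m%:~R * n%:~R * t) *: (upow v n * upow u m).
Proof.
move=> uu uv /(upow_comm m uu)/comm_sym/(upow_comm n uv)/comm_sym ->.
by congr (expi _ *: _); ring.
Qed.

Lemma prod_comm d (u : B) (v : 'I_d -> B) (t : 'I_d -> R) :
  (forall k, u * v k = expi (t k) *: (v k * u)) ->
  u * \prod_(k < d) v k = expi (\sum_(k < d) t k) *: (\prod_(k < d) v k * u).
Proof.
elim: d v t => [|d IH] v t uv.
  by rewrite !big_ord0 expi0 scale1r mulr1 mul1r.
rewrite !big_ord_recr /= mulrA (IH _ (fun i => t (widen_ord (leqnSn d) i))) //.
rewrite -scalerAl -[X in _ *: X = _]mulrA uv -scalerAr scalerA.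
by rewrite -expiD mulrA.
Qed.

(** Reordering moves the power [x j] of [v j] past the power [y k] of [v k] for every [k < j]. The
    induction peels off the last index, whose first factor crosses all the earlier [y]-factors. *)
Lemma ordered_prod_mul d (v : 'I_d -> B) (th : 'I_d -> 'I_d -> R) (x y : 'I_d -> int) :
  (forall j, unitary (v j)) ->
  (forall j k, v j * v k = expi (th k j) *: (v k * v j)) ->
  (\prod_(j < d) upow (v j) (x j)) * (\prod_(j < d) upow (v j) (y j)) =
  expi (\sum_(j < d) \sum_(k < d) (k < j)%N%:R * ((x j)%:~R * (y k)%:~R * th k j)) *:
    \prod_(j < d) upow (v j) (x j + y j).
Proof.
move=> vu vv; elim: d v th x y vu vv => [|d IH] v th x y vu vv.
  by rewrite !big_ord0 expi0 scale1r mulr1.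
pose W (i : 'I_d) : 'I_d.+1 := widen_ord (leqnSn d) i.
rewrite !big_ord_recr /= upowD // -mulrA.
have -> : upow (v ord_max) (x ord_max) * (\prod_(i < d) upow (v (W i)) (y (W i)) *
     upow (v ord_max) (y ord_max)) =
   expi (\sum_(k < d) (x ord_max)%:~R * (y (W k))%:~R * th (W k) ord_max) *:
   (\prod_(i < d) upow (v (W i)) (y (W i)) * (upow (v ord_max) (x ord_max) *
     upow (v ord_max) (y ord_max))).
  rewrite mulrA (prod_comm (t := fun k => (x ord_max)%:~R * (y (W k))%:~R * th (W k) ord_max)).
    by rewrite -scalerAl mulrA.
  by move=> k; exact: upow_comm2.
have /= IHW := IH (v \o W) (fun k j => th (W k) (W j)) (x \o W) (y \o W)
  (fun j => vu (W j)) (fun j k => vv (W j) (W k)).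
rewrite -scalerAr [X in _ *: X = _]mulrA IHW -scalerAl scalerA -expiD; congr (expi _ *: _).
rewrite addrC; congr (_ + _).
  rewrite ltnn mul0r addr0.
  by apply: eq_bigr => k _; rewrite ltn_ord mul1r.
by apply: eq_bigr => j _; rewrite big_ord_recr /= ltnNge ltnW // mul0r addr0.
Qed.

End UnitaryPowers.

Section NCTorus.
Variables (R : realType) (d : nat) (Theta : 'M[R]_d).
Hypothesis skew : skew_symmetric Theta.
Notation K := R[i].
Notation X := 'rV[int]_d.
Implicit Types x y z : X.

(* The cocycle of the ordered monomials u_1^(x_1) ... u_d^(x_d), cohomologous  *)
(* to omega_Theta; it avoids square roots of the commutation phases.           *)
Definition ncform x y : R := \sum_(j < d) \sum_(k < d)
  (k < j)%N%:R * ((x 0 j)%:~R * (y 0 k)%:~R * (2 * pi * Theta k j)).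

Lemma ncformDl x y z : ncform (x + y) z = ncform x z + ncform y z.
Proof.
rewrite /ncform -big_split; apply: eq_bigr => j _; rewrite -big_split.
by apply: eq_bigr => k _; rewrite /= mxE intrD; ring.
Qed.

Lemma ncformDr x y z : ncform x (y + z) = ncform x y + ncform x z.
Proof.
rewrite /ncform -big_split; apply: eq_bigr => j _; rewrite -big_split.
by apply: eq_bigr => k _; rewrite /= mxE intrD; ring.
Qed.

Definition nc_bichar : bicharacter R X.
Proof.
refine (@Bicharacter R X (fun x y => expi (ncform x y)) _ _ _).
- by move=> x y z; rewrite ncformDl expiD.
- by move=> x y z; rewrite ncformDr expiD.
- by move=> x y; exact: norm_expi.
Defined.

Lemma skewE j k : Theta j k = - Theta k j.
Proof. by have /matrixP/(_ k j) := skew; rewrite !mxE. Qed.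

Lemma skew0 j : Theta j j = 0.
Proof. by apply/eqP; have /eqP := skewE j j; rewrite -addr_eq0 -mulr2n mulrn_eq0. Qed.

(** Antisymmetrization recovers the full [Theta] from its triangular half: the terms with [k < j]
    come from [ncform x y], the others from [ncform y x] by skew symmetry. *)
Lemma ncform_comm x y : ncform x y - ncform y x =
  2 * pi * \sum_(j < d) \sum_(k < d) (x 0 j)%:~R * (y 0 k)%:~R * Theta k j.
Proof.
rewrite {2}/ncform exchange_big /ncform -sumrB mulr_sumr.
apply: eq_bigr => j _; rewrite -sumrB mulr_sumr; apply: eq_bigr => k _.
rewrite (skewE j k); case: (ltngtP k j) => [_|_|/ord_inj->]; rewrite ?skew0 /=; ring.
Qed.

Definition unit_vec (j : 'I_d) : X := delta_mx 0 j.

Lemma ncform_unit j k : ncform (unit_vec j) (unit_vec k) =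
  (k < j)%N%:R * (2 * pi * Theta k j).
Proof.
rewrite /ncform (bigD1 j) //= [X in _ + X]big1 ?addr0 => [|i ij].
  rewrite (bigD1 k) //= [X in _ + X]big1 ?addr0 => [|i ik].
    by rewrite !mxE !eqxx !mul1r.
  by rewrite !mxE eqxx (negbTE ik) mulr0 mul0r mulr0.
by rewrite big1 // => l _; rewrite !mxE eqxx (negbTE ij) !mul0r mulr0.
Qed.

Notation A := (tgroup_cstar nc_bichar).
Definition nc_gen (j : 'I_d) : A := tgu nc_bichar (unit_vec j).

Lemma nc_gen_rel : nctorus_rel Theta nc_gen.
Proof.
split=> [j|j k]; first exact: tgu_unitary.
rewrite /nc_gen !tguM scalerA [unit_vec k + _]addrC; congr (_ *: _).
rewrite /= -expiD; congr expi; rewrite -[LHS](subrK (ncform (unit_vec k) (unit_vec j))).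
congr (_ + _); rewrite !ncform_unit (skewE j k).
by case: (ltngtP k j) => [_|_|/ord_inj->]; rewrite ?skew0 /=; ring.
Qed.

Lemma nc_generated : cstar_generated nc_gen.
Proof.
move=> S Salg Su; apply: tgu_generates (Salg) _.
have [Sc [S1 SD SZ SM SS]] := Salg.
(* The points [x] with [tgu x] in [S] form a subgroup, since products and stars reach [tgu (x + y)]
   and [tgu (- x)] up to nonzero scalars; it contains the unit vectors. *)
have S_D x y : S (tgu nc_bichar x) -> S (tgu nc_bichar y) ->
    S (tgu nc_bichar (x + y)).
  move=> Sx Sy; have -> : tgu nc_bichar (x + y) =
      (nc_bichar x y)^-1 *: (tgu nc_bichar x * tgu nc_bichar y).
    by rewrite tguM scalerA mulVf ?scale1r // bichar_neq0.
  by apply: SZ; exact: SM.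
have S_N x : S (tgu nc_bichar x) -> S (tgu nc_bichar (- x)).
  move=> Sx; have -> : tgu nc_bichar (- x) =
      (nc_bichar x x)^-1 *: star (tgu nc_bichar x).
    rewrite (proj_rep_star (tgu_unitary nc_bichar) (tguM nc_bichar)).
    by rewrite scalerA mulVf ?scale1r // bichar_neq0.
  by apply: SZ; exact: SS.
have S_0 : S (tgu nc_bichar 0) by [].
move=> x; rewrite [x]row_sum_delta; apply: (big_ind (fun x => S (tgu nc_bichar x))) => // j _.
have Sj : S (tgu nc_bichar (delta_mx 0 j)) by apply: Su; exists j.
have Sn n : S (tgu nc_bichar (n%:Z *: delta_mx 0 j)).
  elim: n => [|n IH]; first by rewrite scale0r.
  have -> : n.+1%:Z = n%:Z + 1 by rewrite -PoszD addn1.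
  by rewrite scalerDl scale1r; exact: S_D.
by case: (x 0 j) => n //; rewrite NegzE scaleNr; exact: S_N.
Qed.

Lemma nc_universal (B : cstarAlgebra R) (v : 'I_d -> B) : nctorus_rel Theta v ->
  exists f : {lrmorphism A -> B},
    (forall a, f (star a) = star (f a)) /\ (forall j, f (nc_gen j) = v j).
Proof.
move=> [vu vv]; pose h x : B := \prod_(j < d) upow (v j) (x 0 j).
have hU x : unitary (h x).
  apply: big_ind; [exact: unitary1|exact: unitaryM|].
  by move=> j _; exact: unitary_upow.
have hM x y : h x * h y = nc_bichar x y *: h (x + y).
  rewrite /h (ordered_prod_mul (th := fun k j => 2 * pi * Theta k j)) //.
  by congr (_ *: _); apply: eq_bigr => j _; rewrite mxE.
have [f [fs fh]] := tgroup_universal hU hM.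
exists f; split => // j; rewrite fh /h -(big_rmcond (fun k => k == j)).
  by rewrite big_pred1_eq !mxE !eqxx /= expr1.
by move=> k /negbTE kj; rewrite !mxE eqxx kj.
Qed.

Lemma nc_is_nctorus : is_nctorus Theta nc_gen.
Proof. by split; [exact: nc_gen_rel|exact: nc_generated|exact: nc_universal]. Qed.

Lemma nc_simple :
  (forall x, x != 0 -> exists y, expi (2 * pi *
     \sum_(j < d) \sum_(k < d) (x 0 j)%:~R * (y 0 k)%:~R * Theta k j) != 1) ->
  simple_cstar A.
Proof.
move=> nd; apply: tgroup_simple => x /nd[y xy]; exists y.
apply: contra xy => /eqP /= wxy; rewrite -ncform_comm expiD wxy.
by rewrite -expiD subrr expi0.
Qed.

End NCTorus.

(** * The cyclotomic form *)

(** [z] is a root of some ['Phi_d] with [d] dividing [n], because these multiply to ['X^n - 1]; then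
    [z ^+ d = 1], and primitivity forces [d = n]. *)
Lemma Cyclotomic_root (F : fieldType) (n : nat) (z : F) :
  n.-primitive_root z -> root (map_poly intr 'Phi_n) z.
Proof.
move=> zn; have n0 := prim_order_gt0 zn.
have prodF m : (0 < m)%N ->
    \prod_(d <- divisors m) map_poly intr 'Phi_d = 'X^m - 1 :> {poly F}.
  by move=> m0; rewrite -rmorph_prod prod_Cyclotomic // rmorphB /= map_polyXn rmorph1.
have : root ('X^n - 1) z by rewrite rootE !hornerE prim_expr_order // subrr.
rewrite -prodF // -[root _ _]negbK.
rewrite -(big_map (fun d => map_poly intr 'Phi_d) xpredT id) root_bigmul.
move=> /allPn[_ /mapP[d dn ->]]; rewrite negbK => dz.
rewrite -dvdn_divisors // in dn; have d0 := dvdn_gt0 n0 dn.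
suff : root ('X^d - 1) z.
  rewrite rootE !hornerE subr_eq0 -(prim_order_dvd zn) => nd.
  by rewrite -(eqP (_ : d == n)) // eqn_dvd dn.
rewrite -prodF // (bigD1_seq d) ?divisors_uniq -?dvdn_divisors //=.
by rewrite rootM dz.
Qed.

(** In [algC] the minimal polynomial of a primitive root has degree [totient n], so [q] shares no
    root with ['Phi_n] there. Coprimality descends to the rationals and is then transported to
    [F]. *)
Lemma int_poly_not_root (F : numFieldType) (n : nat) (z : F) (q : {poly int}) :
  n.-primitive_root z -> q != 0 -> (size q <= totient n)%N ->
  ~~ root (map_poly intr q) z.
Proof.
move=> zn q0 qn; have n0 := prim_order_gt0 zn.
pose toQ (p : {poly int}) : {poly rat} := map_poly intr p.
have toQE (L : numFieldType) p : map_poly intr p = map_poly (ratr : rat -> L) (toQ p).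
  by rewrite -map_poly_comp; apply: eq_map_poly => m /=; rewrite ratr_int.
suff cop : coprimep (toQ 'Phi_n) (toQ q).
  rewrite rootE; apply: coprimep_root (Cyclotomic_root zn).
  by rewrite !toQE coprimep_map.
rewrite -(coprimep_map (ratr : {rmorphism rat -> algC})).
apply/Pdiv.ClosedField.coprimepP => x; rewrite -!toQE.
have [y yn] := C_prim_root_exists n0.
rewrite (Cintr_Cyclotomic yn) root_cyclotomic // => xn.
have [p [px _] pdiv] := minCpolyP x.
rewrite -rootE toQE pdiv; apply/negP => /dvdp_leq.
have szQ (r : {poly int}) : size (toQ r) = size r.
  by apply: size_map_inj_poly => //; exact: intr_inj.
rewrite -size_poly_eq0 szQ size_poly_eq0 q0 => /(_ isT).
have -> : size p = (totient n).+1.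
  rewrite -(size_map_poly (ratr : {rmorphism rat -> algC})) -px.
  by rewrite (minCpoly_cyclotomic xn) size_cyclotomic.
by rewrite leqNgt ltnS (leq_trans _ qn) // szQ.
Qed.

Section ExpiOne.
Variable R : realType.
Implicit Types r t : R.

Lemma expi_2pi_int (m : int) : expi (2 * pi * m%:~R : R) = 1.
Proof.
have e1 : expi (2 * pi : R) = 1.
  by rewrite /expi mulr_natl cos2pi sin2pi.
have nat1 k : expi (2 * pi * k%:R : R) = 1.
  elim: k => [|k IH]; first by rewrite mulr0 expi0.
  by rewrite -[k.+1]addn1 natrD mulrDr mulr1 expiD IH e1 mulr1.
by case: m => k; rewrite ?NegzE ?mulrNz ?mulrN ?expiN nat1 ?invr1.
Qed.

(** For the fractional part [s], the double angle formula turns [cos (2 * pi * s) = 1] into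
    [sin (pi * s) = 0], impossible for [0 < s < 1]. *)
Lemma expi_eq1 r : expi (2 * pi * r) = 1 -> r = (Num.floor r)%:~R.
Proof.
move=> r1; pose s := r - (Num.floor r)%:~R.
have : expi (2 * pi * s) = 1 by rewrite mulrBr expiD expiN r1 expi_2pi_int invr1 mulr1.
have [s0 s1] : 0 <= s /\ s < 1.
  by rewrite subr_ge0 floor_le ltrBlDl -[ltRHS]/(_ + 1%:~R) -intrD floorD1_gt.
case => + _; rewrite -mulrA mulr_natl cos_mulr2n => c1.
have : sin (pi * s) = 0.
  have := cos2Dsin2 (pi * s); have : cos (pi * s) ^+ 2 = 1 by lra.
  by move=> -> /eqP; rewrite -subr_eq0 addrAC subrr add0r sqrf_eq0 => /eqP.
move: s0; rewrite le_eqVlt => /orP[/eqP s0 _|s0 ss]; first by apply/eqP; rewrite -subr_eq0 -/s -s0.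
have := @sin_gt0_pi R (pi * s); rewrite ss ltxx => H.
by have := H; rewrite mulr_gt0 ?pi_gt0 //= gtr_pMr ?pi_gt0 // s1 => /(_ isT).
Qed.

Lemma primitive_expi n : (0 < n)%N -> n.-primitive_root (expi (2 * pi / n%:R : R)).
Proof.
move=> n0; have nR : n%:R != 0 :> R by rewrite pnatr_eq0 -lt0n.
have eX k : expi (2 * pi / n%:R : R) ^+ k = expi (2 * pi * (k%:R / n%:R)).
  elim: k => [|k IH]; first by rewrite mul0r mulr0 expi0.
  by rewrite exprSr IH -expiD; congr expi; rewrite -natr1; field.
rewrite /primitive_root_of_unity n0; apply/forallP => i; apply/eqP.
rewrite unity_rootE eX; have [->|ni] := eqVneq i.+1 n.
  by rewrite mulfV // (expi_2pi_int 1) eqxx.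
apply/negbTE/negP => /eqP/expi_eq1.
have iR : 0 < (i.+1%:R / n%:R : R) < 1.
  rewrite divr_gt0 ?ltr0n //= ltr_pdivrMr ?ltr0n // mul1r ltr_nat.
  by rewrite ltn_neqAle ni ltn_ord.
rewrite (@floor_def _ _ 0) ?add0r; last by case/andP: iR => /ltW -> ->.
by move=> i0; move: iR; rewrite i0 ltxx.
Qed.

(** A countable set has Lebesgue measure 0, whereas the unit interval has measure 1. *)
Lemma exists_not_in_countable (D : set R) : countable D -> exists t, ~ D t.
Proof.
move=> Dc; apply: contrapT => nD.
have DT : D = setT.
  by rewrite -subTset => t _; apply: contrapT => Dt; apply: nD; exists t.
have := countable_lebesgue_measure0 Dc; rewrite DT => T0.
have : (lebesgue_measure `[0%R, 1%R] <= lebesgue_measure [set: R])%E.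
  by apply: le_measure; rewrite ?inE.
by rewrite T0 lebesgue_measure_itv /= lte_fin ltr01 sube0 lee_fin ler10.
Qed.

End ExpiOne.

(** Sending [x] to the sum of [x_j * z ^+ j] turns the companion matrix into multiplication by [z];
    the last column is the relation [p(z) = 0]. *)
Lemma companion_eigen (F : numFieldType) (d : nat) (p : {poly int}) (z : F) :
  p \is monic -> size p = d.+1 -> root (map_poly intr p) z ->
  (\row_(j < d) z ^+ j) *m map_mx intr (companion d p) = z *: \row_(j < d) z ^+ j.
Proof.
move=> pm sp /rootP pz; apply/rowP => j; rewrite !mxE -exprS.
have [jd|jd] := eqVneq j.+1 d; last first.
  have jd' : (j.+1 < d)%N by rewrite ltn_neqAle jd ltn_ord.
  rewrite (bigD1 (Ordinal jd')) //= big1 ?addr0 => [|i /eqP ij].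
    by rewrite !mxE (negbTE jd) /= eqxx mulr1.
  rewrite !mxE (negbTE jd); case: eqP => [ij'|_]; last by rewrite mulr0.
  by case: ij; apply: val_inj.
move: pz; rewrite horner_coef size_map_inj_poly // ?sp; last exact: intr_inj.
have pd : p`_d = 1 by move/monicP: pm; rewrite lead_coefE sp.
rewrite big_ord_recr /= coef_map /= pd mul1r jd => /eqP.
rewrite addr_eq0 -eqr_oppLR => /eqP <-; rewrite -sumrN.
by apply: eq_bigr => i _; rewrite !mxE jd eqxx coef_map /= mulrNz mulrN commr_int.
Qed.

Lemma complex_ReM (F : rcfType) (u v : F[i]) :
  complex.Re (u * v) = complex.Re u * complex.Re v - complex.Im u * complex.Im v.
Proof. by case: u v => [a b] [c e]. Qed.

Lemma complex_ImM (F : rcfType) (u v : F[i]) :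
  complex.Im (u * v) = complex.Re u * complex.Im v + complex.Im u * complex.Re v.
Proof. by case: u v => [a b] [c e]. Qed.

Section CyclotomicForm.
Variables (R : realType) (n : nat).
Hypothesis n3 : (3 <= n)%N.
Notation d := (totient n).
Notation K := R[i].
Notation M := (cyclotomic_companion n).
Let z : K := expi (2 * pi / n%:R).

Let zn : n.-primitive_root z.
Proof. by apply: primitive_expi; exact: leq_trans n3. Qed.

Let Z : 'rV[K]_d := \row_(j < d) z ^+ j.

Let eigenZ : Z *m map_mx intr M = z *: Z.
Proof.
apply: companion_eigen; [exact: Cyclotomic_monic|exact: size_Cyclotomic|].
exact: Cyclotomic_root.
Qed.

Lemma eigen_row_inj (x : 'I_d -> int) :
  \sum_(j < d) z ^+ j * (x j)%:~R = 0 -> forall j, x j = 0.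
Proof.
move=> zx j; pose q := \poly_(i < d) (if insub i is Some k then x k else 0).
have qj (k : 'I_d) : q`_k = x k by rewrite coef_poly ltn_ord valK.
have [q0|q0] := eqVneq q 0; first by rewrite -qj q0 coef0.
have /negP[] := int_poly_not_root zn q0 (size_poly _ _).
rewrite rootE (@horner_coef_wide _ d); last first.
  exact: leq_trans (size_poly _ _) (size_poly _ _).
apply/eqP; rewrite -[RHS]zx; apply: eq_bigr => k _.
by rewrite coef_map qj commr_int.
Qed.

(** The columns of [M ^+ n - 1] are integer vectors annihilated by the row of powers of [z], hence
    zero by [eigen_row_inj]. *)
Lemma cyclotomic_companionX : M ^+ n = 1.
Proof.
have ZX k : Z *m map_mx intr (M ^+ k) = z ^+ k *: Z.
  elim: k => [|k IH]; first by rewrite !expr0 map_mx1 mulmx1 scale1r.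
  by rewrite exprSr map_mxM mulmxA IH -scalemxAl eigenZ scalerA -exprSr.
have := ZX n; rewrite (prim_expr_order zn) scale1r => Zn.
apply/matrixP => i j; apply/eqP; rewrite -subr_eq0; apply/eqP.
apply: (eigen_row_inj (x := fun i => (M ^+ n) i j - 1%:M i j)).
have /rowP/(_ j) : Z *m map_mx intr (M ^+ n - 1) = 0.
  by rewrite map_mxB map_mx1 mulmxBr Zn mulmx1 subrr.
rewrite mxE [RHS]mxE => E; rewrite -[RHS]E; apply: eq_bigr => k _.
by rewrite !mxE.
Qed.

Lemma cyclotomic_companion_unit : M \in unitmx.
Proof.
have := cyclotomic_companionX; case: n n3 => // m _.
by rewrite exprS => /mulmx1_unit[].
Qed.

Let C : 'rV[R]_d := \row_j complex.Re (z ^+ j).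
Let S : 'rV[R]_d := \row_j complex.Im (z ^+ j).
Let N : 'M[R]_d := map_mx intr M.

(** [C] and [S] are the real and imaginary parts of the embedding of [Z^d] into the complex numbers,
    so this is the matrix of [t * Im (x * conj y)]. *)
Definition cyclotomic_form (t : R) : 'M[R]_d := t *: (S^T *m C - C^T *m S).

Lemma cyclotomic_form_skew t : skew_symmetric (cyclotomic_form t).
Proof.
by rewrite /skew_symmetric linearZ /= linearB /= !trmx_mul !trmxK -scalerN opprB.
Qed.

Lemma eigenC : C *m N = complex.Re z *: C - complex.Im z *: S.
Proof.
apply/rowP => j; have /rowP/(_ j)/(congr1 (@complex.Re R)) := eigenZ.
rewrite !mxE raddf_sum /= => E.
transitivity (complex.Re (z * z ^+ j)); last by rewrite complex_ReM.
rewrite -E; apply: eq_bigr => k _; rewrite !mxE /= !mulrzr.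
by rewrite raddfMz.
Qed.

Lemma eigenS : S *m N = complex.Im z *: C + complex.Re z *: S.
Proof.
apply/rowP => j; have /rowP/(_ j)/(congr1 (@complex.Im R)) := eigenZ.
rewrite !mxE raddf_sum /= => E.
transitivity (complex.Im (z * z ^+ j)); last by rewrite complex_ImM addrC.
rewrite -E; apply: eq_bigr => k _; rewrite !mxE /= !mulrzr.
by rewrite raddfMz.
Qed.

(** [M] acts on the pair [C], [S] by a plane rotation ([eigenC], [eigenS]); the form is their
    determinant, scaled by the determinant [|z|^2 = 1] of that rotation. *)
Lemma cyclotomic_form_invariant t :
  N^T *m cyclotomic_form t *m N = cyclotomic_form t.
Proof.
have -> : N^T *m cyclotomic_form t *m N =
    t *: ((S *m N)^T *m (C *m N) - (C *m N)^T *m (S *m N)).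
  rewrite /cyclotomic_form -scalemxAr -scalemxAl mulmxBr mulmxBl !trmx_mul.
  by rewrite !mulmxA.
rewrite eigenC eigenS /cyclotomic_form; congr (_ *: _).
have z1 : complex.Re z ^+ 2 + complex.Im z ^+ 2 = 1 by rewrite /z /expi /= cos2Dsin2.
apply/matrixP => i j; rewrite !mxE !big_ord1 !mxE.
set a := complex.Re z in z1 *; set b := complex.Im z in z1 *.
set si := complex.Im (z ^+ i); set ci := complex.Re (z ^+ i).
set sj := complex.Im (z ^+ j); set cj := complex.Re (z ^+ j).
transitivity ((a ^+ 2 + b ^+ 2) * (si * cj - ci * sj)); first by ring.
by rewrite z1 mul1r.
Qed.

Lemma cyclotomic_acts t : acts_canonically (cyclic_subgroup M) (cyclotomic_form t).
Proof.
have powM k : M ^+ k \in unitmx.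
  elim: k => [|k IH]; first exact: unitmx1.
  by rewrite exprS unitmx_mul cyclotomic_companion_unit.
have invX k : (map_mx intr (M ^+ k))^T *m cyclotomic_form t *m map_mx intr (M ^+ k) =
    cyclotomic_form t.
  elim: k => [|k IH]; first by rewrite expr0 map_mx1 trmx1 mul1mx mulmx1.
  rewrite exprS map_mxM trmx_mul -[RHS]IH -[in RHS](cyclotomic_form_invariant t).
  by rewrite !mulmxA.
move=> _ [k [->|->]]; split; rewrite ?unitmx_inv //.
have V : map_mx intr (M ^+ k) *m map_mx intr (invmx (M ^+ k)) = 1%:M :> 'M[R]_d.
  by rewrite -map_mxM mulmxV // map_mx1.
rewrite -[X in _ *m X *m _](invX k) !mulmxA -trmx_mul V trmx1 mul1mx.
by rewrite -mulmxA V mulmx1.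
Qed.

Lemma cyclotomic_form_nondegenerate : exists t, forall x : 'rV[int]_d, x != 0 ->
  exists y : 'rV[int]_d, expi (2 * pi * \sum_(j < d) \sum_(k < d)
    (x 0 j)%:~R * (y 0 k)%:~R * cyclotomic_form t k j) != 1.
Proof.
pose Cx (x : 'rV[int]_d) : R := \sum_(j < d) C 0 j * (x 0 j)%:~R.
pose Sx (x : 'rV[int]_d) : R := \sum_(j < d) S 0 j * (x 0 j)%:~R.
pose v (x : 'rV[int]_d) (l : 'I_d) := S 0 l * Cx x - C 0 l * Sx x.
(* For [t] outside the range of [f], the product [t * v x l] is an integer only when [v x l = 0]. A
   vanishing [v] contributes the value 0, by the convention for division, and the range stays
   countable. *)
pose f (u : 'rV[int]_d * 'I_d * int) : R := u.2%:~R / v u.1.1 u.1.2.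
have [t Dt] : exists t, ~ range f t.
  apply: exists_not_in_countable.
  by apply: sub_countable (card_image_le f setT) _; exact: countableP.
exists t => x x0.
have zx : \sum_(j < d) z ^+ j * (x 0 j)%:~R = Cx x +i* Sx x.
  have ReE : complex.Re (\sum_(j < d) z ^+ j * (x 0 j)%:~R) = Cx x.
    rewrite raddf_sum; apply: eq_bigr => j _.
    by rewrite /= !mulrzr raddfMz mxE.
  have ImE : complex.Im (\sum_(j < d) z ^+ j * (x 0 j)%:~R) = Sx x.
    rewrite raddf_sum; apply: eq_bigr => j _.
    by rewrite /= !mulrzr raddfMz mxE.
  by rewrite -ReE -ImE; case: (\sum_(j < d) _).
(* The indices 0 and 1 suffice, as 1 and [z] are linearly independent over the reals: [n >= 3] gives
   [0 < 2 * pi / n < pi], hence a positive sine, and also [d > 1]. *)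
have [l vl] : exists l, v x l != 0.
  have d1 : (1 < d)%N by rewrite totient_gt1.
  have vE0 : v x (Ordinal (ltnW d1)) = - Sx x.
    by rewrite /v !mxE /= mul0r mul1r sub0r.
  have [Sx0|Sx0] := eqVneq (Sx x) 0; last first.
    by exists (Ordinal (ltnW d1)); rewrite vE0 oppr_eq0.
  exists (Ordinal d1); rewrite /v Sx0 mulr0 subr0 !mxE /= mulf_neq0 //.
    rewrite gt_eqF // sin_gt0_pi // !(divr_gt0, mulr_gt0) ?pi_gt0 ?ltr0n //=; last first.
      exact: leq_trans n3.
    rewrite ltr_pdivrMr ?ltr0n; last exact: leq_trans n3.
    by rewrite mulrC ltr_pM2l ?pi_gt0 // ltr_nat.
  apply: contra x0 => /eqP Cx0; apply/eqP/rowP => j; rewrite mxE.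
  by move: j; apply: eigen_row_inj; rewrite zx Cx0 Sx0.
exists (delta_mx 0 l).
have -> : \sum_(j < d) \sum_(k < d) (x 0 j)%:~R * ((delta_mx 0 l : 'rV[int]_d) 0 k)%:~R *
    cyclotomic_form t k j = t * v x l :> R.
  rewrite /v /Cx /Sx !mulr_sumr -sumrB mulr_sumr; apply: eq_bigr => j _.
  rewrite (bigD1 l) //= big1 ?addr0 => [|k kl].
    by rewrite !mxE !big_ord1 !mxE !eqxx /=; ring.
  by rewrite mxE eqxx (negbTE kl) mulr0 mul0r.
apply/eqP => /expi_eq1 tv; apply: Dt; exists (x, l, Num.floor (t * v x l)) => //.
by rewrite /f /= -tv mulfK.
Qed.

End CyclotomicForm.

Theorem theorem1p2 (R : realType) (n : nat) (hn : (3 <= n)%N) :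
  exists Theta : 'M[R]_(totient n),
    skew_symmetric Theta /\
    acts_canonically (cyclic_subgroup (cyclotomic_companion n)) Theta /\
    (exists (A : cstarAlgebra R) (u : 'I_(totient n) -> A),
       is_nctorus Theta u /\ simple_cstar A).
Proof.
have [t nd] := cyclotomic_form_nondegenerate R hn.
have sk := cyclotomic_form_skew n t.
exists (cyclotomic_form n t); split => //; split; first exact: cyclotomic_acts.
exists (tgroup_cstar (nc_bichar (cyclotomic_form n t))), (nc_gen (cyclotomic_form n t)).
by split; [exact: nc_is_nctorus|exact: nc_simple].
Qed.
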